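(* Let $n\ge 1$ be an integer, $m>-1$, $\nu_1^2,\nu_2^2\ge 0$, and let $\mu_1,\mu_2>1$ if $-1<m<0$, and $\mu_1,\mu_2>0$ if $m\ge 0$, be such that $\delta_1,\delta_2>0$, where $\delta_i=(\mu_i-1)^2-4\nu_i^2$. Let $\beta_i=\frac{\mu_i+1-\sqrt{\delta_i}}{2}$, $i=1,2$. Suppose that $(u_0,u_1,v_0,v_1)\in D\times D$ are initial data with $\mathrm{supp}\,(u_0,u_1,v_0,v_1)\subset B_M$ for some $M>0$ and $$\liminf_{R\to+\infty}\int_{|x|<R}\Bigl(\frac{\mu_1-1+\sqrt{\delta_1}}{2}u_0(x)+u_1(x)\Bigr)dx>0,\qquad \liminf_{R\to+\infty}\int_{|x|<R}\Bigl(\frac{\mu_2-1+\sqrt{\delta_2}}{2}v_0(x)+v_1(x)\Bigr)dx>0.$$ If $p,q>1$ satisfy $$p>\frac{1+\beta_1}{2m+1+\beta_2},\qquad q>\frac{1+\beta_2}{2m+1+\beta_1}$$ and $$\Gamma_m(n,p,q,\beta_1,\beta_2):=\max\Big\{\frac{p+1}{pq-1}-\frac{\beta_1-1}{2},\ \frac{q+1}{pq-1}-\frac{\beta_2-1}{2}\Big\}-\frac{(m+1)n}{2}\ \ge 0,$$ then the energy solution $(u,v)$ to the system $$\partial_t^2u-t^{2m}\Delta u+\frac{\mu_1}{t}\partial_tu+\frac{\nu_1^2}{t^2}u=|v|^p,\quad \partial_t^2v-t^{2m}\Delta v+\frac{\mu_2}{t}\partial_tv+\frac{\nu_2^2}{t^2}v=|u|^q,\quad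 t>1,\ x\in\mathbb{R}^n,$$ with $(u,\partial_tu,v,\partial_tv)(1,x)=(u_0,u_1,v_0,v_1)(x)$, blows up in finite time (i.e. it cannot exist globally: there is no energy solution on $[1,T)$ with $T=\infty$).
   Context: $B_r=\{x\in\mathbb{R}^n:|x|\le r\}$. $D:=D^1=(L^1\cap H^1)\times(L^1\cap L^2)$ (function spaces over $\mathbb{R}^n$), so the data condition means $(u_0,u_1)\in D$ and $(v_0,v_1)\in D$. Put $\phi_m(t)=\frac{t^{m+1}}{m+1}$. Energy solution: for data $(u_0,u_1,v_0,v_1)\in D\times D$ supported in $B_M$, $(u,v)$ is an energy solution on $[1,T)$ if $(u,v)\in\big(C([1,T);H^1(\mathbb{R}^n))\cap C^1([1,T);L^2(\mathbb{R}^n))\big)^2$, $\mathrm{supp}\,(u,v)(t,\cdot)\subset B_{\phi_m(t)-\phi_m(1)+M}$ for any $t\in(1,T)$, and for all $\varPhi_1,\varPhi_2\in C_0^\infty([1,T)\times\mathbb{R}^n)$ $$\iint_{[1,T)\times\mathbb{R}^n}u\Bigl(\partial_t^2\varPhi_1-t^{2m}\Delta\varPhi_1-\partial_t\bigl(\tfrac{\mu_1}{t}\varPhi_1\bigr)+\tfrac{\nu_1^2}{t^2}\varPhi_1\Bigr)dxdt=\int_{\mathbb{R}^n}\Bigl(-u_0\,\partial_t\varPhi_1(1,x)+(\mu_1u_0+u_1)\varPhi_1(1,x)\Bigr)dx+\iint_{[1,T)\times\mathbb{R}^n}|v|^p\varPhi_1\,dxdt,$$ $$\iint_{[1,T)\times\mathbb{R}^n}v\Bigl(\partial_t^2\varPhi_2-t^{2m}\Delta\varPhi_2-\partial_t\bigl(\tfrac{\mu_2}{t}\varPhi_2\bigr)+\tfrac{\nu_2^2}{t^2}\varPhi_2\Bigr)dxdt=\int_{\mathbb{R}^n}\Bigl(-v_0\,\partial_t\varPhi_2(1,x)+(\mu_2v_0+v_1)\varPhi_2(1,x)\Bigr)dx+\iint_{[1,T)\times\mathbb{R}^n}|u|^q\varPhi_2\,dxdt.$$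 *)

(* Defs.v *)
From HB Require Import structures.
From mathcomp Require Import all_boot all_order all_algebra.
From mathcomp Require Import all_classical all_reals all_analysis.
Set Implicit Arguments.
Unset Strict Implicit.
Unset Printing Implicit Defensive.
Import Order.TTheory GRing.Theory Num.Theory.
Import numFieldNormedType.Exports.
Local Open Scope classical_set_scope.
Local Open Scope ring_scope.

(* Borel sigma-algebra of R^n, generated by the coordinate maps (as for tuples
   in the library). *)
Section row_measurable.
Context (R : realType) (n : nat).

Let coord_rV : 'I_n -> 'rV[R]_n -> R := fun i x => x ord0 i.

Let rV_set0 : g_sigma_preimage coord_rV set0.
Proof. exact: sigma_algebra0. Qed.

Let rV_setC A : g_sigma_preimage coord_rV A -> g_sigma_preimage coord_rV (~` A).
Proof. exact: sigma_algebraC. Qed.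

Let rV_bigcup (F : (set 'rV[R]_n)^nat) :
  (forall i, g_sigma_preimage coord_rV (F i)) ->
  g_sigma_preimage coord_rV (\bigcup_i (F i)).
Proof. exact: sigma_algebra_bigcup. Qed.

HB.instance Definition _ := @isMeasurable.Build default_measure_display
  'rV[R]_n (g_sigma_preimage coord_rV) rV_set0 rV_setC rV_bigcup.

Lemma measurable_coord (i : 'I_n) :
  measurable_fun [set: 'rV[R]_n] (fun x : 'rV[R]_n => x ord0 i : R).
Proof.
move=> _ Y mY; rewrite setTI; apply: sub_sigma_algebra => /=.
rewrite -bigcup_seq/=; exists i => /=; first by rewrite mem_index_enum.
by exists Y => //; rewrite setTI.
Qed.

Lemma measurable_fun_rV d (T : measurableType d) (f : T -> 'rV[R]_n) :
  (forall i, measurable_fun [set: T] (fun x => f x ord0 i : R)) ->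
  measurable_fun [set: T] f.
Proof.
move=> mf; suff prefS : g_sigma_preimage (fun i => coord_rV i \o f) `<=` measurable.
  move=> _ A mA; apply: prefS.
  by rewrite g_sigma_preimage_comp; exists A.
apply: smallest_sub; first exact: sigma_algebra_measurable.
rewrite -bigcup_seq; apply: bigcup_sub => i _ A [B mB <-]; exact: mf.
Qed.

End row_measurable.
Section lebesgue_step.
Context (R : realType) (n : nat).
Local Open Scope ereal_scope.

Definition cons_rV (z : measurableTypeR R * 'rV[R]_n) : 'rV[R]_n.+1 :=
  row_mx (z.1 : R)%:M z.2.

Definition uncons_rV (x : 'rV[R]_n.+1) : measurableTypeR R * 'rV[R]_n :=
  (x ord0 ord0, \row_i x ord0 (lift ord0 i)).

Lemma cons_rVK : cancel cons_rV uncons_rV.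
Proof.
have e0 : (ord0 : 'I_n.+1) = lshift n (ord0 : 'I_1) by exact: val_inj.
have eS i : lift ord0 i = rshift 1 i :> 'I_n.+1 by exact: val_inj.
move=> [a y]; congr pair.
  transitivity (row_mx (a : R)%:M y ord0 (lshift n ord0)); last first.
    by rewrite row_mxEl mxE.
  by rewrite -e0.
apply/rowP => i; rewrite mxE eS.
exact: (row_mxEr (a : R)%:M y ord0 i).
Qed.

Lemma measurable_cons_rV : measurable_fun setT cons_rV.
Proof.
apply: measurable_fun_rV => i.
have [->|[j ->]] : i = ord0 \/ exists j : 'I_n, i = lift ord0 j.
  by case: (unliftP ord0 i) => [j ->|->]; [right; exists j|left].
- rewrite (_ : (fun z => _) = fst); last first.
    by apply/funext => z; rewrite -[in RHS](cons_rVK z).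
  exact: measurable_fst.
- rewrite (_ : (fun z => _) = (fun y : 'rV[R]_n => y ord0 j : R) \o snd).
    by apply: measurableT_comp; [exact: measurable_coord|exact: measurable_snd].
  by apply/funext => z; rewrite -[in RHS](cons_rVK z) /= mxE.
Qed.

Lemma measurable_uncons_rV : measurable_fun setT uncons_rV.
Proof.
apply/measurable_fun_pairP; split; first exact: measurable_coord.
apply: measurable_fun_rV => i.
rewrite (_ : (fun x => _) = fun x : 'rV[R]_n.+1 => x ord0 (lift ord0 i)).
  exact: measurable_coord.
by apply/funext => x /=; rewrite mxE.
Qed.

Variable mu : {sigma_finite_measure set 'rV[R]_n -> \bar R}.

Definition lebesgue_step : set 'rV[R]_n.+1 -> \bar R :=
  pushforward (lebesgue_measure \x mu) cons_rV.

Let step0 : lebesgue_step set0 = 0.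
Proof. by rewrite /lebesgue_step /pushforward preimage_set0 measure0. Qed.

Let step_ge0 A : 0 <= lebesgue_step A.
Proof. by rewrite /lebesgue_step /pushforward measure_ge0. Qed.

Let step_sigma_additive : semi_sigma_additive lebesgue_step.
Proof.
move=> F mF tF mUF; rewrite /lebesgue_step /pushforward preimage_bigcup.
have mpre A : measurable A -> measurable (cons_rV @^-1` A).
  by move=> mA; rewrite -[X in measurable X]setTI; exact: measurable_cons_rV.
apply: measure_semi_sigma_additive.
- by move=> k; exact: mpre.
- apply/trivIsetP => /= i j _ _ ij; rewrite -preimage_setI.
  by move/trivIsetP : tF => /(_ _ _ _ _ ij) ->//; rewrite preimage_set0.
- by rewrite -preimage_bigcup; exact: mpre.
Qed.

HB.instance Definition _ := isMeasure.Build _ _ _ lebesgue_step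
  step0 step_ge0 step_sigma_additive.

Let unpickle_pair (k : nat) : nat * nat := odflt (0, 0)%N (unpickle k).

Let step_sigma_finite : sigma_finite setT lebesgue_step.
Proof.
have [F FT mF] := sigma_finiteT (@lebesgue_measure R).
have [G GT mG] := sigma_finiteT mu.
exists (fun k => uncons_rV @^-1` (F (unpickle_pair k).1 `*` G (unpickle_pair k).2)).
  rewrite -preimage_bigcup (_ : \bigcup_k _ = setT) ?preimage_setT//.
  apply/seteqP; split=> // -[a y] _.
  have [i _ Fi] : (\bigcup_i F i) a by rewrite -FT.
  have [j _ Gj] : (\bigcup_j G j) y by rewrite -GT.
  by exists (pickle (i, j)) => //=; rewrite /unpickle_pair pickleK.
move=> k; set i := (_ k).1; set j := (_ k).2.
have [mFi Fioo] := mF i; have [mGj Gjoo] := mG j.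
have mFG := measurableX mFi mGj; split.
  by rewrite -[X in measurable X]setTI; exact: measurable_uncons_rV.
rewrite /lebesgue_step /pushforward (_ : _ @^-1` _ = F i `*` G j).
  by rewrite product_measure1E// lte_mul_pinfty// ge0_fin_numE.
by rewrite -comp_preimage (_ : _ \o _ = id)//; apply/funext => z; exact: cons_rVK.
Qed.

HB.instance Definition _ := Measure_isSigmaFinite.Build _ _ _ lebesgue_step
  step_sigma_finite.

End lebesgue_step.

(* Lebesgue measure on (the Borel sets of) R^n, as the iterated product of the
   one-dimensional Lebesgue measure. *)
Fixpoint lebesgue_rV (R : realType) (n : nat) :
    {sigma_finite_measure set 'rV[R]_n -> \bar R} :=
  match n with
  | 0 => dirac (0 : 'rV[R]_0)
  | k.+1 => lebesgue_step (lebesgue_rV R k)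
  end.

Section sobolev.
Context (R : realType) (n : nat).
Notation E := 'rV[R]_n.
Notation leb := (lebesgue_rV R n).

Definition enorm (x : E) : R := Num.sqrt (\sum_j x ord0 j ^+ 2).

Definition eball (r : R) : set E := [set x | enorm x <= r].

(* Essential support: complement of the largest open set on which f = 0 a.e.;
   this is the support of the class of f modulo null sets. *)
Definition esupp (f : E -> R) : set E :=
  [set x | ~ exists2 U, open_nbhs x U & {ae leb, forall y, U y -> f y = 0}].

Definition L2norm (f : E -> R) : \bar R := 'N[leb]_2[EFin \o f].

(* In finite dimension, k-fold continuous directional differentiability in all
   directions is the usual class C^k. *)
Fixpoint Ck (V : normedModType R) (k : nat) (f : V -> R) : Prop :=
  match k with
  | 0 => continuous f
  | k'.+1 => continuous f /\
      forall v, (forall x, derivable f x v) /\ Ck k' (fun x => 'D_v f x)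
  end.

Definition smooth (V : normedModType R) (f : V -> R) := forall k, Ck k f.

Definition Cc_infty (f : E -> R) :=
  smooth f /\ compact (closure [set x | f x != 0]).

Definition basis_rV (j : 'I_n) : E := delta_mx ord0 j.

Definition is_weak_derivative (j : 'I_n) (f g : E -> R) :=
  forall phi, Cc_infty phi ->
    (\int[leb]_x (f x * 'D_(basis_rV j) phi x)%:E =
     - \int[leb]_x (g x * phi x)%:E)%E.

Definition H1 (f : E -> R) :=
  f \in Lfun leb 2%:E /\
  forall j, exists2 g, g \in Lfun leb 2%:E & is_weak_derivative j f g.

(* The weak derivative of f in L^2, unique a.e. when it exists, 0 otherwise. *)
Definition weak_derivative (j : 'I_n) (f : E -> R) : E -> R :=
  xget (cst 0) [set g | g \in Lfun leb 2%:E /\ is_weak_derivative j f g].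

Definition H1norm (f : E -> R) : \bar R :=
  ((L2norm f `^ 2 + \sum_(j < n) L2norm (weak_derivative j f) `^ 2) `^ 2^-1)%E.

(* (w0, w1) in D = (L^1 /\ H^1) x (L^1 /\ L^2) *)
Definition data_space (w0 w1 : E -> R) :=
  [/\ w0 \in Lfun leb 1, H1 w0, w1 \in Lfun leb 1 & w1 \in Lfun leb 2%:E].

(* Curves are maps w with w t a representative of the value at time t. *)
Definition continuous_curve (X : set (E -> R)) (N : (E -> R) -> \bar R)
    (I : set R) (w : R -> E -> R) :=
  forall t, I t -> X (w t) /\ N (w s \- w t) @[s --> within I (nbhs t)] --> 0%E.

Definition C_H1 (I : set R) (w : R -> E -> R) := continuous_curve H1 H1norm I w.

Definition C_L2 (I : set R) (w : R -> E -> R) :=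
  continuous_curve [set f | f \in Lfun leb 2%:E] L2norm I w.

Definition C1_L2 (I : set R) (w : R -> E -> R) :=
  C_L2 I w /\
  exists2 w' : R -> E -> R, C_L2 I w' &
    forall t, I t ->
      L2norm (fun x => (w s x - w t x) / (s - t) - w' t x)
        @[s --> within I (t^')] --> 0%E.

End sobolev.

Section spacetime.
Context (R : realType) (n : nat).
Notation E := 'rV[R]_n.

Definition time_interval (T : \bar R) : set R := [set t | 1 <= t /\ (t%:E < T)%E].

Definition slab (T : \bar R) : set (R * E) := time_interval T `*` setT.

Definition lebesgue_spacetime : {measure set (measurableTypeR R * E) -> \bar R} :=
  (lebesgue_measure \x lebesgue_rV R n)%E.

Definition dt (Phi : R * E -> R) (z : R * E) : R := 'D_(1, 0) Phi z.

Definition laplacian (Phi : R * E -> R) (z : R * E) : R :=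
  \sum_(j < n) 'D_(0, basis_rV R j) (fun y => 'D_(0, basis_rV R j) Phi y) z.

(* C_0^infty([1,T) x R^n): restrictions to t >= 1 of smooth functions on R x R^n;
   the support relative to {t >= 1} is compact and contained in [1,T) x R^n, but
   may meet the initial slice {t = 1}. *)
Definition test_function (T : \bar R) (Phi : R * E -> R) :=
  let S := closure [set z | 1 <= z.1 /\ Phi z != 0] in
  [/\ smooth Phi, compact S & S `<=` slab T].

(* Weak form of w_tt - t^(2m) Lap w + (mu/t) w_t + (nu^2/t^2) w = F with data
   (w0, w1) at t = 1.  The integrals are extended-real valued: for F >= 0 and
   w in C([1,T); L^2), taking Phi >= 0 forces F to be locally integrable. *)
Definition weak_solution (m mu nu : R) (T : \bar R) (w0 w1 : E -> R)
    (w F : R -> E -> R) :=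
  forall Phi, test_function T Phi ->
    (\int[lebesgue_spacetime]_(z in slab T)
       (w z.1 z.2 *
         (dt (dt Phi) z - z.1 `^ (2 * m) * laplacian Phi z
          - dt (fun y => mu / y.1 * Phi y) z
          + nu ^+ 2 / z.1 ^+ 2 * Phi z))%:E
     = \int[lebesgue_rV R n]_x
         (- (w0 x * dt Phi (1, x)) + (mu * w0 x + w1 x) * Phi (1, x))%:E
       + \int[lebesgue_spacetime]_(z in slab T) (F z.1 z.2 * Phi z)%:E)%E.

Definition phi_ (m t : R) : R := t `^ (m + 1) / (m + 1).

(* Joint measurability in (t, x) selects a representative for which the
   space-time integrals make sense; every class-valued curve has one. *)
Record energy_solution (m mu1 mu2 nu1 nu2 p q M : R) (u0 u1 v0 v1 : E -> R)
    (T : \bar R) (u v : R -> E -> R) : Prop := EnergySolution {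
  es_measurable_u : measurable_fun (slab T : set (measurableTypeR R * E))
    (fun z => u z.1 z.2) ;
  es_measurable_v : measurable_fun (slab T : set (measurableTypeR R * E))
    (fun z => v z.1 z.2) ;
  es_regular_u : C_H1 (time_interval T) u /\ C1_L2 (time_interval T) u ;
  es_regular_v : C_H1 (time_interval T) v /\ C1_L2 (time_interval T) v ;
  es_support : forall t, 1 < t -> (t%:E < T)%E ->
    esupp (u t) `|` esupp (v t) `<=` eball (phi_ m t - phi_ m 1 + M) ;
  es_weak_u : weak_solution m mu1 nu1 T u0 u1 u (fun t x => `|v t x| `^ p) ;
  es_weak_v : weak_solution m mu2 nu2 T v0 v1 v (fun t x => `|u t x| `^ q)
}.

End spacetime.

Definition delta_ {R : realType} (mu nu : R) : R := (mu - 1) ^+ 2 - 4 * nu ^+ 2.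

Definition beta_ {R : realType} (mu nu : R) : R :=
  (mu + 1 - Num.sqrt (delta_ mu nu)) / 2.

Definition Gamma_ {R : realType} (m : R) (n : nat) (p q beta1 beta2 : R) : R :=
  Num.max ((p + 1) / (p * q - 1) - (beta1 - 1) / 2)
          ((q + 1) / (p * q - 1) - (beta2 - 1) / 2)
  - (m + 1) * n%:R / 2.

Definition liminf_ball_integral {R : realType} {n : nat} (f : 'rV[R]_n -> R) : \bar R :=
  limf_einf (fun r : R =>
    (\int[lebesgue_rV R n]_(x in [set x | (enorm x < r)%R]) (f x)%:E)%E)
    (pinfty_nbhs R).

(* Main.v *)
(** Testing the equations against [t^beta1 psi(t/r)] and [t^beta2 psi(t/r)], constant in
    space on the cone that contains the supports, kills the Laplacian; since
    [t^beta_i] solves the adjoint of the linear ODE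
    [w'' + (mu_i/t) w' + (nu_i^2/t^2) w = 0], only terms carrying a derivative of
    [psi] survive, and these live on the shell [r <= t <= 2r].  With
    [X(r)] and [Y(r)] the integrals of [|v|^p t^beta1 psi] and [|u|^q t^beta2 psi],
    Hoelder's inequality on the shell gives
      [I1 + X(r) <= C r^a (Y-tail)^(1/q)],  [I2 + Y(r) <= C r^a' (X-tail)^(1/p)],
    where the tails are the parts over [t >= r], and [I1, I2 > 0] come from the data.
    [Gamma >= 0] says that [a + a'/q <= 0] (or the symmetric condition), whence
    [I1 + X(r) <= K (X-tail)^(1/(pq))].  As [1/(pq) < 1], [X] is bounded, although
    every dyadic shell contributes at least a fixed positive amount to it. *)
Require Import Defs.
From mathcomp Require Import all_boot all_order all_algebra.
From mathcomp Require Import all_classical all_reals all_analysis.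
From mathcomp Require Import measurable_realfun ring lra.
Set Implicit Arguments.
Unset Strict Implicit.
Unset Printing Implicit Defensive.
Import Order.TTheory GRing.Theory Num.Theory.
Import numFieldNormedType.Exports.
Local Open Scope classical_set_scope.
Local Open Scope ring_scope.

(** * Functions of class [C^k] *)

(** Three obstacles shape the argument. The integrals in [weak_solution] are extended reals, so
    bounding [X] by a sublinear power of itself says nothing unless [X] is known to be finite;
    finiteness comes from continuity in time with values in [L^2], which makes the side of the
    identity containing the solution linearly finite ([weighted_lty]). Supports are controlled only
    almost everywhere on each time slice, so the solution is replaced by a representative, [trunc],
    that vanishes at every point off the cone. Test functions must be smooth on all of [R x R^n];
    hence a positive substitute for the time variable in the power weight, and a spatial cutoff that
    is a product of one-variable steps adapted to cubes. The form of the data condition is forced: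
    on the supports of the data the test function has value [1] and time derivative [beta] at
    [t = 1], which leaves [(mu - beta) * w0 + w1], and [mu - beta] equals
    [(mu - 1 + sqrt delta) / 2] for the smaller indicial root [beta]. *)

Section Ck_calculus.
Context {R : realType}.
Implicit Types (V : normedModType R) (k : nat).

Lemma Ck_continuous V k (f : V -> R) : Ck k f -> continuous f.
Proof. by case: k => [//|k [cf _]]. Qed.

Lemma CkW V k (f : V -> R) : Ck k.+1 f -> Ck k f.
Proof.
elim: k f => [|k IH] f; first by case.
by move=> [cf df]; split=> // v; have [dfv /IH] := df v.
Qed.

Lemma Ck_cst V k (c : R) : Ck k (fun _ : V => c).
Proof.
elim: k c => [|k IH] c; first by move=> x; exact: cst_continuous.
split; first by move=> x; exact: cst_continuous.
move=> v; split=> [x|]; first exact: derivable_cst.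
rewrite (_ : (fun x => 'D_v _ x) = fun=> 0); first exact: IH.
by apply/funext => x; exact: derive_cst.
Qed.

(** The difference quotient of a linear map in direction [v] is exactly [f v] for [h != 0], so all
    directional derivatives are constant functions. *)
Lemma Ck_linear V k (f : V -> R) :
  (forall (h : R) v x, f (h *: v + x) = h * f v + f x) -> continuous f -> Ck k f.
Proof.
move=> lf cf; case: k => [//|k]; split=> // v.
have Q x : (fun h : R => h^-1 *: ((f \o shift x) (h *: v) - f x)) @ 0^' --> f v.
  apply: (@cvg_trans _ ((fun=> f v) @ 0^')); last exact: cvg_cst.
  apply: near_eq_cvg; near=> h => /=.
  have h0 : h != 0 by near: h; exact: nbhs_dnbhs_neq.
  by rewrite lf addrK /GRing.scale /= mulrA mulVf// mul1r.
split=> [x|]; first by apply/cvg_ex; exists (f v).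
rewrite (_ : (fun x => 'D_v _ x) = fun=> f v); first exact: Ck_cst.
by apply/funext => x; exact: cvg_lim (Q x).
Unshelve. all: by end_near. Qed.

Lemma CkD V k (f g : V -> R) : Ck k f -> Ck k g -> Ck k (fun x => f x + g x).
Proof.
elim: k f g => [|k IH] f g; first by move=> cf cg x; exact: cvgD (cf x) (cg x).
move=> [cf df] [cg dg]; split; first by move=> x; exact: cvgD (cf x) (cg x).
move=> v; have [df1 df2] := df v; have [dg1 dg2] := dg v.
split=> [x|]; first exact: derivableD.
rewrite (_ : (fun x => 'D_v _ x) = fun x => 'D_v f x + 'D_v g x); first exact: IH.
by apply/funext => x; rewrite (deriveD (df1 x) (dg1 x)).
Qed.

Lemma CkM V k (f g : V -> R) : Ck k f -> Ck k g -> Ck k (fun x => f x * g x).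
Proof.
elim: k f g => [|k IH] f g; first by move=> cf cg x; exact: cvgM (cf x) (cg x).
move=> Cf Cg; have [cf df] := Cf; have [cg dg] := Cg.
split; first by move=> x; exact: cvgM (cf x) (cg x).
move=> v; have [df1 df2] := df v; have [dg1 dg2] := dg v.
split=> [x|]; first exact: derivableM.
rewrite (_ : (fun x => 'D_v _ x) = fun x => f x * 'D_v g x + g x * 'D_v f x).
  by apply: CkD; apply: IH => //; exact: CkW.
by apply/funext => x; rewrite (deriveM (df1 x) (dg1 x)).
Qed.

Lemma CkX V k (f : V -> R) l : Ck k f -> Ck k (fun x => f x ^+ l).
Proof.
move=> Cf; elim: l => [|l IH].
  by rewrite (_ : (fun x => _) = fun=> 1) //; exact: Ck_cst.
rewrite (_ : (fun x => _) = fun x => f x * f x ^+ l); first exact: CkM.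
by apply/funext => x; rewrite exprS.
Qed.

Lemma Ck_prod V k (I : Type) (s : seq I) (f : I -> V -> R) :
  (forall i, Ck k (f i)) -> Ck k (fun x => \prod_(i <- s) f i x).
Proof.
move=> Cf; elim: s => [|i s IH].
  rewrite (_ : (fun x => _) = fun=> 1); first exact: Ck_cst.
  by apply/funext => x; rewrite big_nil.
rewrite (_ : (fun x => _) = fun x => f i x * \prod_(j <- s) f j x).
  exact: CkM.
by apply/funext => x; rewrite big_cons.
Qed.

Lemma CkV V k (f : V -> R) : (forall x, f x != 0) -> Ck k f ->
  Ck k (fun x => (f x)^-1).
Proof.
move=> f0; elim: k => [|k IH]; first by move=> cf x; exact: cvgV (cf x).
move=> Cf; have [cf df] := Cf; split; first by move=> x; exact: cvgV (cf x).
move=> v; have [df1 df2] := df v; split=> [x|]; first exact: derivableV.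
have -> : (fun x => 'D_v (fun y => (f y)^-1) x) =
    fun x => -1 * ((f x)^-1 ^+ 2 * 'D_v f x).
  by apply/funext => x; rewrite deriveV// mulN1r exprVn scaleNr.
apply: CkM; first exact: Ck_cst.
by apply: CkM => //; apply: CkX; apply: IH; exact: CkW.
Qed.

(** Along the line [h *: v + x] a directional derivative in [V] becomes an ordinary derivative at
    [h = 0], where the one-variable chain rule applies. *)
Lemma is_derive_comp1 V (f : V -> R) (g : R -> R) (x v : V) (df dg : R) :
  is_derive x v f df -> is_derive (f x) 1 g dg ->
  is_derive x v (g \o f) (dg * df).
Proof.
move=> [dfx fE] gfx; pose l := fun h : R => f (h *: v + x).
have lE : l 0 = f x by rewrite /l scale0r add0r.
have dl : is_derive (0 : R) 1 l df.
  apply: DeriveDef; first by exact: (derivable1P f x v).1.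
  rewrite -fE /derive /l; set g1 := fun h => h^-1 *: _; set g2 := fun h => h^-1 *: _.
  suff -> : g1 = g2 by [].
  apply/funext => h; rewrite /g1 /g2 /=; rewrite scale0r add0r addr0.
  by rewrite [_%:A]mulr1.
rewrite -lE in gfx.
have [dgl glE] := is_derive1_comp gfx dl.
apply: DeriveDef; first by exact: (derivable1P (g \o f) x v).2.
rewrite -glE /derive /l; set g1 := fun h => h^-1 *: _; set g2 := fun h => h^-1 *: _.
suff -> : g1 = g2 by [].
apply/funext => h; rewrite /g1 /g2 /=; rewrite scale0r add0r addr0.
by rewrite [_%:A]mulr1.
Qed.

Lemma Ck_comp V k (f : V -> R) (g : R -> R) : Ck k f -> Ck k g -> Ck k (g \o f).
Proof.
elim: k f g => [|k IH] f g.
  by move=> cf cg x; apply: continuous_comp; [exact: cf|exact: cg].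
move=> Cf Cg; have [cf df] := Cf; have [cg dg] := Cg.
split; first by move=> x; apply: continuous_comp; [exact: cf|exact: cg].
move=> v; have [df1 df2] := df v; have [dg1 dg2] := dg 1.
have D x : is_derive x v (g \o f) ('D_1 g (f x) * 'D_v f x).
  by apply: is_derive_comp1; apply: derivableP.
split=> [x|]; first by have [] := D x.
rewrite (_ : (fun x => 'D_v _ x) = fun x => ('D_1 g \o f) x * 'D_v f x).
  by apply: CkM => //; apply: IH => //; exact: CkW.
by apply/funext => x; have [_ ->] := D x.
Qed.

(** [Ck] quantifies over all directions, but on the line the derivative in direction [v] is [v]
    times the derivative in direction [1]. *)
Lemma Ck_1d k (f df : R -> R) :
  (forall x : R, is_derive x 1 f (df x)) -> Ck k df -> Ck k.+1 f.
Proof.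
move=> Df Cdf; split.
  move=> x; apply: differentiable_continuous; apply/derivable1_diffP.
  by have [] := Df x.
have Dv (v x : R) : is_derive x v f (df x * v).
  apply: DeriveDef.
    by apply/diff_derivable/derivable1_diffP; have [] := Df x.
  have [d1 d2] := Df x.
  rewrite deriveE; last exact/derivable1_diffP.
  by rewrite -[v in LHS]mulr1 [LHS]linearZ /= -deriveE ?d2 1?mulrC//;
    exact/derivable1_diffP.
move=> v; split=> [x|]; first by have [] := Dv v x.
rewrite (_ : (fun x => 'D_v _ x) = fun x => df x * v); last first.
  by apply/funext => x; have [] := Dv v x.
by apply: CkM => //; exact: Ck_cst.
Qed.

End Ck_calculus.

(** * A smooth step function *)

Section smooth_step.
Context {R : realType}.
Implicit Types (j k : nat) (x : R).

(* For [j = 0] this is the classical flat function [exp (-1/x)]; including the powers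
   [x^-j] makes the family closed under differentiation up to linear combinations. *)
Definition flat j x : R := if 0 < x then x ^- j * expR (- x^-1) else 0.

Lemma flat_ge0 j x : 0 <= flat j x.
Proof.
by rewrite /flat; case: ifP => // x0; rewrite mulr_ge0 ?expR_ge0// invr_ge0 exprn_ge0// ltW.
Qed.

Lemma flat_le0 j x : x <= 0 -> flat j x = 0.
Proof. by rewrite /flat ltNge => ->. Qed.

(** One term of the exponential series at [y = 1/x]: [exp y >= y^(j+1) / (j+1)!]. *)
Lemma flat_bound j x : 0 < x -> flat j.+1 x <= j.+1`!%:R.
Proof.
move=> x0; rewrite /flat x0 -exprVn expRN ler_pdivrMr ?expR_gt0//.
have := @expR_ge1Dxn R x^-1 j; rewrite invr_ge0 ltW// => /(_ isT).
have f0 : (0 : R) < j.+1`!%:R by rewrite ltr0n fact_gt0.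
move=> H; rewrite mulrC -ler_pdivrMr//; apply: le_trans H; by rewrite lerDr.
Qed.

(** Quadratic decay at the origin makes the difference quotient of [flat j] at [0] tend to [0]. *)
Lemma flat_sqr_bound j x : `|flat j x| <= j.+2`!%:R * x ^+ 2.
Proof.
have [x0|x0] := leP x 0; first by rewrite flat_le0// normr0 mulr_ge0// sqr_ge0.
rewrite ger0_norm ?flat_ge0//.
have -> : flat j x = flat j.+2 x * x ^+ 2.
  rewrite /flat x0 -addn2 exprD; field.
  by rewrite gt_eqF// expf_neq0// gt_eqF.
by rewrite ler_wpM2r ?sqr_ge0// flat_bound.
Qed.

Lemma is_derive_flat j x :
  is_derive x 1 (flat j) (flat j.+2 x - j%:R * flat j.+1 x).
Proof.
have [x0|x0|->] := ltgtP x 0.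
- rewrite !flat_le0 ?ltW// mulr0 subr0.
  apply: (@near_eq_is_derive R R R (cst 0)).
  by near=> y; rewrite flat_le0// ltW//; near: y; exact: lt_nbhsl.
- have xn0 : x != 0 by rewrite gt_eqF.
  apply: (@near_eq_is_derive R R R (fun x => (x ^-1) ^+ j * expR (- x^-1))).
    near=> y; rewrite /flat ifT ?exprVn//.
    by near: y; exact: lt_nbhsr.
  have dV : is_derive x 1 (fun y : R => y^-1) (- x ^- 2).
    by apply: is_derive_eq (is_deriveV xn0 (is_derive_id x 1)) _; rewrite [LHS]mulr1.
  have dX : is_derive x 1 (fun y : R => y^-1 ^+ j)
     (j%:R * x^-1 ^+ j.-1 * - x ^- 2).
    by have := @is_deriveX R R (fun y : R => y^-1) j x 1 _ dV; rewrite exprfctE.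
  have dE : is_derive x 1 (fun y : R => expR (- y^-1)) (expR (- x^-1) * x ^- 2).
    apply: is_derive1_comp.
    rewrite -[x ^- 2]opprK; exact: is_deriveN.
  apply: is_derive_eq (is_deriveM dX dE) _.
  rewrite /flat x0 /GRing.scale /=; case: j {dX} => [|j] /=.
    by rewrite expr0 mul1r !mul0r mulr0 addr0 subr0 mulrC.
  rewrite -!exprVn !exprS expr0; ring.
- rewrite !flat_le0// mulr0 subr0.
  suff H : (fun h : R =>
    h^-1 *: ((flat j \o shift (0 : R)) (h *: 1) - flat j 0)) @ 0^' --> (0 : R).
    by apply: DeriveDef; [apply/cvg_ex; exists 0|exact: cvg_lim H].
  rewrite [flat j 0]flat_le0//.
  pose C : R := j.+2`!%:R.
  have C0 : 0 < C by rewrite /C ltr0n fact_gt0.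
  apply/cvgr0Pnorm_le => e e0; near=> h.
  rewrite subr0 /= addr0 [h *: 1]mulr1 normrM normfV.
  have h0 : 0 < `|h| by rewrite normr_gt0; near: h; exact: nbhs_dnbhs_neq.
  rewrite mulrC ler_pdivrMr//.
  apply: le_trans (flat_sqr_bound j h) _.
  rewrite -real_normK ?num_real// expr2 mulrA ler_pM2r// -ler_pdivlMl//.
  near: h; apply: dnbhs0_le.
  by rewrite mulr_gt0// invr_gt0.
Unshelve. all: by end_near. Qed.

(** The induction on [k] runs over all [j] at once, since differentiation raises the index. *)
Lemma Ck_flat k j : Ck k (flat j).
Proof.
elim: k j => [|k IH] j.
  move=> x; apply: differentiable_continuous; apply/derivable1_diffP.
  by have [] := is_derive_flat j x.
apply: Ck_1d (is_derive_flat j) _; apply: CkD => //.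
rewrite (_ : (fun x => _) = fun x => (- j%:R) * flat j.+1 x).
  by apply: CkM => //; exact: Ck_cst.
by apply/funext => x; rewrite mulNr.
Qed.

Definition step x : R := flat 0 x / (flat 0 x + flat 0 (1 - x)).

Lemma flat_gt0 j x : 0 < x -> 0 < flat j x.
Proof. by move=> x0; rewrite /flat x0 mulr_gt0 ?expR_gt0// invr_gt0 exprn_gt0. Qed.

(** At least one of [x] and [1 - x] is positive. *)
Lemma step_den_gt0 x : 0 < flat 0 x + flat 0 (1 - x).
Proof.
have [x0|x0] := leP x 0; last by rewrite ltr_pwDl ?flat_gt0 ?flat_ge0.
by rewrite ltr_wpDl ?flat_ge0// flat_gt0//; lra.
Qed.

Lemma step_le0 x : x <= 0 -> step x = 0.
Proof. by move=> x0; rewrite /step flat_le0// mul0r. Qed.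

Lemma step_ge1 x : 1 <= x -> step x = 1.
Proof.
move=> x1; rewrite /step [flat 0 (1 - x)]flat_le0 ?addr0 ?divff//; last by lra.
by rewrite gt_eqF// flat_gt0//; lra.
Qed.

Lemma step_ge0 x : 0 <= step x.
Proof. by rewrite divr_ge0 ?flat_ge0// ltW// step_den_gt0. Qed.

Lemma step_gt0 x : 0 < x -> 0 < step x.
Proof. by move=> x0; rewrite divr_gt0 ?flat_gt0// step_den_gt0. Qed.

Lemma step_le1 x : step x <= 1.
Proof. by rewrite ler_pdivrMr ?step_den_gt0// mul1r lerDl flat_ge0. Qed.

Lemma Ck_1B (V : normedModType R) k (f : V -> R) : Ck k f -> Ck k (fun x : V => 1 - f x).
Proof.
move=> Cf; rewrite (_ : (fun x : V => _) = fun x : V => 1 + (-1) * f x).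
  by apply: CkD; [exact: Ck_cst|apply: CkM => //; exact: Ck_cst].
by apply/funext => x; rewrite mulN1r.
Qed.

Lemma Ck_id k : Ck k (@id R).
Proof. by apply: Ck_linear => // x; exact: cvg_id. Qed.

Lemma Ck_step k : Ck k step.
Proof.
apply: CkM; first exact: Ck_flat.
apply: CkV => [x|]; first by rewrite gt_eqF// step_den_gt0.
apply: CkD; first exact: Ck_flat.
apply: (@Ck_comp _ _ _ (fun x : R => 1 - x)); last exact: Ck_flat.
exact/Ck_1B/Ck_id.
Qed.

(* Stands in for the identity on [[1/2, +oo)]: being smooth and positive on the whole
   line, its real powers are smooth, whereas [t `^ b] is singular at [0]. *)
Definition pos_id x : R := x * step (2 * x) + (1 - step (2 * x)).

Lemma Ck_step_double k : Ck k (fun x => step (2 * x)).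
Proof.
apply: (@Ck_comp _ _ _ (fun x : R => 2 * x)); last exact: Ck_step.
by apply: CkM; [exact: Ck_cst|exact: Ck_id].
Qed.

Lemma Ck_pos_id k : Ck k pos_id.
Proof.
apply: CkD; last exact/Ck_1B/Ck_step_double.
by apply: CkM; [exact: Ck_id|exact: Ck_step_double].
Qed.

Lemma pos_idE x : 1 / 2 <= x -> pos_id x = x.
Proof. by move=> x0; rewrite /pos_id step_ge1 ?mulr1 ?subrr ?addr0//; lra. Qed.

Lemma pos_id_gt0 x : 0 < pos_id x.
Proof.
rewrite /pos_id; have [x0|x0] := leP x 0.
  by rewrite step_le0 ?mulr0 ?add0r ?subr0//; lra.
have := step_le1 (2 * x); have := step_gt0 (_ : 0 < 2 * x); set s := step _.
by move=> /(_ ltac:(lra)) s0 s1; rewrite ltr_wpDr ?subr_ge0// mulr_gt0.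
Qed.

Lemma Ck_powR (V : normedModType R) k (f : V -> R) (b : R) :
  (forall x : V, 0 < f x) -> Ck k f -> Ck k (fun x : V => f x `^ b).
Proof.
move=> f0; elim: k b => [|k IH] b Cf.
  move=> x; apply: (@continuous_comp _ _ _ f (fun y => y `^ b)); first exact: Cf.
  apply: differentiable_continuous; apply/derivable1_diffP.
  by apply: derivable_powR; rewrite in_itv/= f0.
have [cf df] := Cf.
have D (x v : V) : is_derive x v (fun x : V => f x `^ b) (b * f x `^ (b - 1) * 'D_v f x).
  apply: (@is_derive_comp1 _ _ f (fun y => y `^ b)); first by apply: derivableP;
    have [] := df v.
  exact: is_derive1_powR.
split=> [x|v].
  apply: (@continuous_comp _ _ _ f (fun y => y `^ b)); first exact: cf.
  apply: differentiable_continuous; apply/derivable1_diffP.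
  by apply: derivable_powR; rewrite in_itv/= f0.
split=> [x|]; first by have [] := D x v.
rewrite (_ : (fun x : V => 'D_v _ x) = fun x : V => b * f x `^ (b - 1) * 'D_v f x).
  apply: CkM; last by have [] := df v.
  by apply: CkM; [exact: Ck_cst|apply: IH; exact: CkW].
by apply/funext => x; have [] := D x v.
Qed.

End smooth_step.

(** * Lebesgue measure and essential supports in [R^n] *)

Section euclidean.
Context {R : realType}.

(** Cubes replace Euclidean balls in the estimates: their measure follows from the product
    construction of [lebesgue_rV], and a smooth cutoff adapted to them is a product over the
    coordinates. *)
Definition cube (n : nat) (r : R) : set 'rV[R]_n := [set x | forall j, `|x ord0 j| <= r].

Lemma measurable_cube n r : measurable (@cube n r).
Proof.
rewrite (_ : cube r = \bigcap_(j in [set: 'I_n]) ((fun x : 'rV[R]_n =>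
  x ord0 j) @^-1` `[- r, r]%classic)).
  apply: fin_bigcap_measurable => // j _.
  rewrite -[X in measurable X]setTI; apply: measurable_coord => //.
apply/seteqP; split=> [x cx j _|x cx j] /=; first by rewrite in_itv/= -ler_norml.
by have := cx j I; rewrite /= in_itv/= -ler_norml.
Qed.

Lemma lebesgue_rV_cube n (r : R) : 0 <= r ->
  (lebesgue_rV R n (@cube n r) <= ((2 * r) ^+ n)%:E)%E.
Proof.
move=> r0; elim: n => [|n IH].
  by rewrite /= expr0 /dirac/= indicE lee_fin lern1 leq_b1.
rewrite [lebesgue_rV _ _ _]/= /lebesgue_step /pushforward.
rewrite (_ : _ @^-1` _ = `[- r, r]%classic `*` cube r).
  rewrite product_measure1E//; last exact: measurable_cube.
  rewrite exprS EFinM; apply: lee_pmul => //; rewrite ?measure_ge0//.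
  pose I : interval R := `[- r, r].
  suff : (@lebesgue_measure R [set` I] <= (2 * r)%:E)%E by [].
    rewrite lebesgue_measure_itv/= lte_fin.
    by case: ifP => // _; [rewrite -EFinD lee_fin; lra|rewrite lee_fin; lra].
have K := @cons_rVK R n.
have e0 (z : measurableTypeR R * 'rV[R]_n) : cons_rV z ord0 ord0 = z.1 :> R by
  rewrite -{2}(K z).
have eS (z : measurableTypeR R * 'rV[R]_n) j :
  cons_rV z ord0 (lift ord0 j) = z.2 ord0 j by rewrite -{2}(K z) /= mxE.
apply/seteqP; split=> -[a y] /=.
  move=> c; split=> /=; first by rewrite in_itv/= -ler_norml; have := c ord0; rewrite e0.
  by move=> j; have := c (lift ord0 j); rewrite eS.
rewrite in_itv/= -ler_norml => -[ca cy] i.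
by case: (unliftP ord0 i) => [j ->|->]; rewrite ?eS ?e0.
Qed.

Lemma eball_cube n r : @eball R n r `<=` cube r.
Proof.
move=> x; rewrite /eball /enorm /= => xr j; apply: le_trans xr.
rewrite -sqrtr_sqr ler_wsqrtr// (bigD1 j)//= lerDl sumr_ge0// => i _.
exact: sqr_ge0.
Qed.

Lemma measurable_enorm n : measurable_fun setT (@enorm R n).
Proof.
rewrite /enorm (_ : (fun x => _) = fun x : 'rV[R]_n => (\sum_j x ord0 j ^+ 2) `^ 2^-1).
  apply: (@measurableT_comp _ _ _ _ _ _ (fun y : R => y `^ 2^-1)).
    exact: measurable_powR.
  by apply: measurable_sum => j; apply: measurable_funX; exact: measurable_coord.
by apply/funext => x; rewrite powR12_sqrt// sumr_ge0// => i _; rewrite sqr_ge0.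
Qed.

Lemma rat_box_nbhs n (x : 'rV[R]_n) (U : set 'rV[R]_n) : open_nbhs x U ->
  exists (c : 'rV[rat]_n) (k : nat),
    (forall j, `|x ord0 j - ratr (c ord0 j)| < k.+1%:R^-1) /\
    [set y : 'rV[R]_n | forall j, `|y ord0 j - ratr (c ord0 j)| < k.+1%:R^-1] `<=` U.
Proof.
move=> /open_nbhs_nbhs /nbhs_ballP[e /= e0 eU].
(* Both [x] and any [y] of the box lie within [1/(k+1) < e/2] of the rational center. *)
have e20 : 0 < e / 2 by rewrite divr_gt0.
have [k _ /(_ k (leqnn k)) /= ke] := near_infty_natSinv_lt (PosNum e20).
have cP j : exists c : rat, `|x ord0 j - ratr c| < k.+1%:R^-1.
  have k0 : 0 < k.+1%:R^-1 :> R by rewrite invr_gt0.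
  have [c] : exists c : rat, ratr c \in `]x ord0 j - k.+1%:R^-1, x ord0 j[.
    by apply: rat_in_itvoo; rewrite ltrBlDr ltrDl.
  rewrite in_itv/= => /andP[c1 c2]; exists c.
  by rewrite ger0_norm ?subr_ge0 1?ltW// ltrBlDr addrC -ltrBlDr.
exists (\row_j xget 0 [set c : rat | `|x ord0 j - ratr c| < k.+1%:R^-1]), k.
set c := \row_j _.
have H j : `|x ord0 j - ratr (c ord0 j)| < k.+1%:R^-1.
  have [d dP] := cP j.
  by rewrite mxE; case: xgetP => [? -> //|/(_ d) /=]; rewrite dP.
split=> // y yP; apply: eU; split=> // i j.
rewrite (_ : i = ord0); last exact: ord1.
rewrite /ball/= (le_lt_trans (ler_distD (ratr (c ord0 j)) _ _))//.
by rewrite [`|ratr _ - _|]distrC; apply: lt_trans (ltrD (H j) (yP j)) _;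
  rewrite [ltRHS]splitr ltrD.
Qed.

(* Lindelof: the null neighbourhoods are shrunk to countably many rational boxes. *)
Lemma esupp_ae n (f : 'rV[R]_n -> R) (A : set 'rV[R]_n) : esupp f `<=` A ->
  {ae lebesgue_rV R n, forall x, ~ A x -> f x = 0}.
Proof.
move=> fA.
pose B (i : 'rV[rat]_n * nat) : set 'rV[R]_n :=
  [set y : 'rV[R]_n | forall j, `|y ord0 j - ratr (i.1 ord0 j)| < i.2.+1%:R^-1].
(* [G i] is empty unless [f] vanishes almost everywhere on the box [B i], so each member of the
   countable union is negligible. *)
pose G i := [set y | (lebesgue_rV R n).-negligible (B i `&` [set y | f y != 0]) /\
   B i y /\ f y != 0].
pose F k := if unpickle k is Some i then G i else set0.
have : (lebesgue_rV R n).-negligible (\bigcup_k F k).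
  apply: negligible_bigcup => k; rewrite /F; case: unpickle => [i|];
    last exact: negligible_set0.
  have [H|H] := pselect ((lebesgue_rV R n).-negligible (B i `&` [set y | f y != 0])).
    by apply: negligibleS H => y [].
  rewrite (_ : G i = set0); first exact: negligible_set0.
  by apply/seteqP; split=> y //= [].
apply: negligibleS => x /= /not_implyP[Ax /eqP fx0].
have : ~ esupp f x by move/fA.
move=> /contrapT [U xU Uf]; have [c [k [xc cU]]] := rat_box_nbhs xU.
exists (pickle (c, k)) => //; rewrite /F pickleK; split; last by split.
apply: negligibleS Uf => y /= [yB /eqP fy0]; apply/not_implyP; split=> //.
exact: cU.
Qed.

End euclidean.

(** * Truncation to the propagation cone *)

Section truncation.
Context {R : realType} {n : nat}.
Notation E := 'rV[R]_n.
Notation leb := (lebesgue_rV R n).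
Notation st := (lebesgue_spacetime R n).

Lemma Lfun2_measurable (f : E -> R) : f \in Lfun leb 2%:E -> measurable_fun setT f.
Proof. by move=> /sub_Lfun_mfun; rewrite inE. Qed.

(** Continuity bounds the norm near each time, by Minkowski's inequality and a difference of norm
    less than [1]; compactness of [[1, T0]] makes the bound uniform. *)
Lemma L2_local_bound (w : R -> E -> R) (T0 : R) : C_L2 (time_interval +oo%E) w ->
  exists C : R, forall t, 1 <= t <= T0 -> (L2norm (w t) <= C%:E)%E.
Proof.
move=> cw.
have It t : 1 <= t -> time_interval (R := R) +oo%E t by move=> t1; split=> //; rewrite ltry.
suff [C [_ HC]] : \forall C \near +oo, `[1, T0] `<=` [set t | (L2norm (w t) <= C%:E)%E].
  by exists (C + 1) => t tT; apply: HC; rewrite ?ltrDl//= in_itv.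
have K : compact (`[1, T0]%classic : set R) by exact: segment_compact.
move/compact_near_coveringP/near_covering_withinP in K.
apply: K => t; rewrite /= in_itv/= => /andP[t1 _].
have [wtL wcvg] := cw t (It t t1).
have wtfin : (L2norm (w t) < +oo)%E.
  by move: (wtL : w t \in Lfun leb 2%:E) => /sub_Lfun_finLfun; rewrite inE.
have /= near1 : \forall s \near within (time_interval +oo%E) (nbhs t),
    (L2norm (w s \- w t)%R < 1%:E)%E.
  have l01 : (0 < 1%:E :> \bar R)%E by rewrite lte01.
  exact: (wcvg _ (open_ereal_lt' l01)).
rewrite near_withinE in near1.
near=> s C => /=; rewrite in_itv/= => /andP[s1 _].
have /(_ (It s s1)) H1 : time_interval +oo%E s -> (L2norm (w s \- w t)%R < 1%:E)%E.
  by near: s; exact: near1.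
have wsL : w s \in Lfun leb 2%:E := (cw s (It s s1)).1.
have {}wtL : w t \in Lfun leb 2%:E := wtL.
have -> : w s = (w s \- w t) \+ w t by apply/funext => x /=; rewrite subrK.
apply: (@le_trans _ _ (L2norm (w s \- w t)%R + L2norm (w t))%E).
  apply: minkowski_EFin; [|exact: Lfun2_measurable|by rewrite ler1n].
  by apply: measurable_funB; exact: Lfun2_measurable.
apply: (@le_trans _ _ (1 + fine (L2norm (w t)))%:E).
  rewrite EFinD fineK; first by apply: leeD => //; exact: ltW.
  by rewrite ge0_fin_numE// /L2norm Lnorm_ge0.
by rewrite lee_fin; near: C; by apply: nbhs_pinfty_ge; exact: num_real.
Unshelve. all: by end_near. Qed.


(** The inequality [1 < z.1] is strict because the support condition is imposed only after the
    initial time; the slice [t = 1] is null in spacetime. *)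
Definition light_cone (rho : R -> R) : set (measurableTypeR R * E) :=
  [set z | 1 < z.1 /\ cube (rho z.1) z.2].

Definition trunc (rho : R -> R) (w : R -> E -> R) : measurableTypeR R * E -> R :=
  (fun z => w z.1 z.2) \_ (light_cone rho).

Lemma measurable_coord2 (j : 'I_n) :
  measurable_fun setT (fun z : measurableTypeR R * E => z.2 ord0 j : R).
Proof. by apply: measurableT_comp (@measurable_coord R n j) measurable_snd. Qed.

Lemma measurable_comp_fst (f : R -> R) : measurable_fun setT f ->
  measurable_fun setT (fun z : measurableTypeR R * E => f z.1).
Proof. by move=> mf; apply: measurableT_comp mf measurable_fst. Qed.

Lemma measurable_ler d (T : measurableType d) (f g : T -> R) :
  measurable_fun setT f -> measurable_fun setT g -> measurable [set z | f z <= g z].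
Proof.
move=> mf mg; have := measurable_fun_ler mf mg => /(_ measurableT [set true] _).
by rewrite setTI; apply.
Qed.

Lemma measurable_ltr d (T : measurableType d) (f g : T -> R) :
  measurable_fun setT f -> measurable_fun setT g -> measurable [set z | f z < g z].
Proof.
move=> mf mg; have := measurable_fun_ltr mf mg => /(_ measurableT [set true] _).
by rewrite setTI; apply.
Qed.

Lemma measurable_norm_powR d (T : measurableType d) (f : T -> R) r :
  measurable_fun setT f -> measurable_fun setT (fun x => `|f x| `^ r).
Proof.
move=> mf; apply: (measurableT_comp (measurable_powR r)).
exact: measurableT_comp.
Qed.

Lemma measurable_slab : measurable (slab +oo%E : set (measurableTypeR R * E)).
Proof.
rewrite (_ : slab _ = [set z : measurableTypeR R * E | (1 : R) <= z.1]).
  apply: measurable_ler; first exact: measurable_cst.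
  exact: (@measurable_comp_fst id).
by apply/seteqP; split=> -[t x] /=; [case=> -[]|move=> t1; split=> //; split=> //;
  rewrite ltry].
Qed.

Lemma light_cone_slab rho : light_cone rho `<=` slab +oo%E.
Proof. by move=> z [/ltW z1 _]; split=> //; split=> //; rewrite ltry. Qed.

Lemma measurable_light_cone rho : measurable_fun setT rho -> measurable (light_cone rho).
Proof.
move=> mr.
rewrite (_ : light_cone rho = [set z : measurableTypeR R * E | (1 : R) < z.1] `&`
   \bigcap_(j in [set: 'I_n]) [set z : measurableTypeR R * E | `|z.2 ord0 j| <= rho z.1]).
  apply: measurableI.
    by apply: measurable_ltr; [exact: measurable_cst|exact: (@measurable_comp_fst id)].
  apply: fin_bigcap_measurable => // j _; apply: measurable_ler.
    by apply: measurableT_comp => //; exact: measurable_coord2.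
  exact: measurable_comp_fst.
apply/seteqP; split=> z [z1 z2]; split=> // j; first by move=> _; exact: z2.
exact: (z2 j).
Qed.

Variables (rho : R -> R) (w : R -> E -> R).
Hypothesis mrho : measurable_fun setT rho.
Hypothesis mw : measurable_fun (slab +oo%E : set (measurableTypeR R * E)) (fun z =>
  w z.1 z.2).

Lemma measurable_trunc : measurable_fun setT (trunc rho w).
Proof.
apply: (proj1 (measurable_restrictT (fun z : measurableTypeR R * E =>
  w z.1 z.2) (measurable_light_cone mrho))).
apply: (measurable_funS measurable_slab (@light_cone_slab rho) mw).
Qed.

Lemma trunc_neq0 z : trunc rho w z != 0 -> light_cone rho z.
Proof. by rewrite /trunc /patch; case: ifPn => [|_]; rewrite ?inE ?eqxx. Qed.

(** Tonelli turns exceptional sets that are null on each slice into one null set of spacetime. The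
    initial slice [A] is treated apart; [B] collects the later points off the cone where [w] is
    nonzero. *)
Lemma trunc_ae :
  (forall t, 1 < t -> {ae leb, forall x, ~ cube (rho t) x -> w t x = 0}) ->
  {ae st, forall z, slab +oo%E z -> w z.1 z.2 = trunc rho w z}.
Proof.
move=> w0.
pose A : set (measurableTypeR R * E) := [set 1] `*` setT.
(* The intersection with the slab makes [B] measurable, since [w] is measurable only there. *)
pose B : set (measurableTypeR R * E) :=
  [set z | 1 < z.1] `&` (~` light_cone rho `&` (slab +oo%E `&` [set z | w z.1 z.2 != 0])).
have mA : measurable A by apply: measurableX => //; exact: measurable_set1.
have mB : measurable B.
  apply: measurableI.
    by apply: measurable_ltr; [exact: measurable_cst|exact: (@measurable_comp_fst id)].
  apply: measurableI; first by apply: measurableC; exact: measurable_light_cone.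
  rewrite (_ : [set z | w z.1 z.2 != 0] = (fun z => w z.1 z.2) @^-1` (~` [set 0])).
    by have := mw measurable_slab (measurableC (measurable_set1 (0 : R))).
  by apply/seteqP; split=> z /= /eqP.
have NA : st.-negligible A.
  apply/negligibleP => //; rewrite /lebesgue_spacetime.
  rewrite [LHS]product_measure1E//.
  by rewrite [X in (X * _)%E]lebesgue_measure_set1 mul0e.
have NB : st.-negligible B.
  apply/negligibleP => //.
  suff : (\int[lebesgue_measure]_t (leb (xsection B t)) = 0)%E by [].
  apply: integral0_eq => t _.
  have [t1|t1] := ltP 1 t; last first.
    rewrite (_ : xsection B t = set0) ?measure0//.
    apply/seteqP; split=> // x; rewrite /xsection/= inE => -[/= t1' _].
    by rewrite ltNge t1 in t1'.
  apply: measure_negligible; first exact: measurable_xsection.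
  apply: negligibleS (w0 t t1) => x.
  rewrite /xsection/= inE => -[/= _ [nc [_ /eqP wtx]]]; apply/not_implyP; split=> //.
  by move=> cx; apply: nc.
apply: negligibleS (negligibleU NA NB) => z /= /not_implyP[sz wz].
have [z1|z1] := eqVneq (z.1 : R) 1; first by left; split.
have z1' : (1 : R) < z.1 by rewrite lt_neqAle eq_sym z1; have [[]] := sz.
right; split=> //; rewrite /trunc /patch in wz; move: wz; case: ifPn => //.
by rewrite notin_setE => nz /eqP; split.
Qed.

(** By Tonelli the integral is at most the squared uniform bound of [L2_local_bound] times the
    length of [[1, T0]]. *)
Lemma trunc_L2 (T0 : R) : C_L2 (time_interval +oo%E) w ->
  (\int[st]_z (trunc rho w z ^+ 2 * (z.1 <= T0)%R%:R)%:E < +oo)%E.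
Proof.
move=> cw; have [C HC] := L2_local_bound T0 cw.
pose g z : \bar R := (trunc rho w z ^+ 2 * (z.1 <= T0)%R%:R)%:E.
have g0 z : (0 <= g z)%E by rewrite lee_fin mulr_ge0// sqr_ge0.
have mg : measurable_fun setT g.
  apply/measurable_EFinP.
  apply: measurable_funM; first by apply: measurable_funX; exact: measurable_trunc.
  rewrite (_ : (fun x => _) = \1_[set z : measurableTypeR R * E | (z.1 : R) <= T0]).
    by apply: measurable_indic; apply: measurable_ler;
      [exact: (@measurable_comp_fst id)|exact: measurable_cst].
  by apply/funext => z; rewrite indicE; congr (_%:R); congr nat_of_bool; apply/idP/idP;
    rewrite inE.
rewrite /lebesgue_spacetime -/g (fubini_tonelli1 _ mg g0).
apply: (@le_lt_trans _ _ (\int[lebesgue_measure]_t ((C ^+ 2)%:E * (\1_`[1%R, T0] t)%:E))%E).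
  apply: ge0_le_integral => //.
  - by move=> t _; apply: integral_ge0.
  - exact: measurable_fun_fubini_tonelli_F.
  - suff : measurable_fun setT (fun t : measurableTypeR R => C ^+ 2 * \1_`[1%R, T0] t).
      by move/measurable_EFinP.
    by apply: measurable_funM => //; exact: measurable_indic.
  move=> t _; rewrite /fubini_F /=.
  have [tI|tI] := boolP (t \in `[1, T0]%R); last first.
    rewrite integral0_eq; first by rewrite mule_ge0 ?lee_fin ?sqr_ge0.
    move=> x _; rewrite /g /=; have [tT|_] := boolP (t <= T0)%R; last by rewrite mulr0.
    have := @trunc_neq0 (t, x); case: eqP => [->|_ /(_ isT) [/= t1 _]].
      by rewrite expr0n mul0r.
    by rewrite in_itv/= tT ltW in tI.
  rewrite indicE mem_set// mule1.
  have tI' := tI; rewrite in_itv/= in tI'; have /andP[t1 tT] := tI'.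
  have wL : w t \in Lfun leb 2%:E by apply: (cw t _).1; split=> //; rewrite ltry.
  have mwt := Lfun2_measurable wL.
  apply: (@le_trans _ _ (\int[leb]_x (`|w t x| `^ 2)%R%:E)%E).
    apply: ge0_le_integral => //.
    - exact: (measurableT_comp mg (pair1_measurable t)).
    - by apply/measurable_EFinP; exact: measurable_norm_powR.
    move=> x _; rewrite /g /= tT mulr1 lee_fin powR_mulrn// real_normK ?num_real//.
    by rewrite /trunc /patch; case: ifP => // _; rewrite expr0n sqr_ge0.
  have := HC t tI'; rewrite /L2norm => HCt.
  under eq_integral do rewrite -poweR_EFin -abse_EFin.
  rewrite -powR_Lnorm//.
  apply: (@le_trans _ _ (C%:E `^ 2)%E).
    apply: gt0_ler_poweR => //; rewrite ?in_itv/= ?Lnorm_ge0 ?leey ?andbT//.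
    by apply: le_trans HCt; exact: Lnorm_ge0.
  rewrite poweR_EFin powR_mulrn//.
  by rewrite -lee_fin; apply: le_trans HCt; exact: Lnorm_ge0.
rewrite ge0_integralZl//.
- rewrite integral_indic// setIT.
  pose I : interval R := `[1, T0].
  suff H : (@lebesgue_measure R [set` I] < +oo)%E.
    by rewrite lte_mul_pinfty// lee_fin sqr_ge0.
  by rewrite lebesgue_measure_itv/= lte_fin; case: ifP => // _; rewrite -EFinD ltry.
- by apply/measurable_EFinP; exact: measurable_indic.
- by rewrite lee_fin sqr_ge0.
Qed.

End truncation.

(** * Derivatives in spacetime and their measurability *)

Section derivatives.
Context {R : realType}.

Lemma derive_line_cst (V : normedModType R) (f : V -> R) (a v : V) :
  (forall h : R, f (h *: v + a) = f a) -> 'D_v f a = 0.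
Proof.
move=> H; rewrite /derive (_ : (fun h : R => _) = cst 0); first exact: lim_cst.
by apply/funext => h /=; rewrite H subrr scaler0.
Qed.

Lemma is_derive_sep (V : normedModType R) (f : R -> R) (c : V -> R) (z : R * V) (d : R) :
  is_derive z.1 1 f d ->
  is_derive z (1, 0) (fun y : R * V => f y.1 * c y.2) (d * c z.2).
Proof.
move=> fd; have [D E] : is_derive z.1 1 (fun t => f t * c z.2) (d * c z.2).
  have H := @is_deriveM R R f (cst (c z.2)) z.1 1 d 0 fd (is_derive_cst _ _ _).
  by apply: is_derive_eq H _; rewrite scaler0 add0r /GRing.scale /= mulrC.
have Q : (fun h : R => h^-1 *: (((fun y : R * V =>
  f y.1 * c y.2) \o shift z) (h *: (1, 0)) - f z.1 * c z.2)) =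
    (fun h : R => h^-1 *: (((fun t => f t * c z.2) \o shift z.1) (h *: 1) - f z.1 * c z.2)).
  by apply/funext => h /=; rewrite scaler0 add0r.
apply: DeriveDef; first by rewrite /derivable Q.
by rewrite -E /derive Q.
Qed.

Lemma dt_sep n (f : R -> R) (c : 'rV[R]_n -> R) (z : R * 'rV[R]_n) : derivable f z.1 1 ->
  dt (fun y : R * 'rV[R]_n => f y.1 * c y.2) z = 'D_1 f z.1 * c z.2.
Proof. by move=> /derivableP /(@is_derive_sep _ _ c) []. Qed.

Lemma continuous_coord_snd n (j : 'I_n) :
  continuous (fun z : R * 'rV[R]_n => z.2 ord0 j).
Proof.
move=> z; apply: (@continuous_comp _ _ _ snd (fun x : 'rV[R]_n => x ord0 j)).
  exact: cvg_snd.
exact: coord_continuous.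
Qed.

Lemma Ck_fst n k : Ck k (fun z : R * 'rV[R]_n => z.1).
Proof. by apply: Ck_linear => // z; exact: cvg_fst. Qed.

Lemma Ck_coord_snd n k (j : 'I_n) : Ck k (fun z : R * 'rV[R]_n => z.2 ord0 j).
Proof.
by apply: Ck_linear; [move=> h v x; rewrite /= !mxE|exact: continuous_coord_snd].
Qed.

(** The derivative is the pointwise limit of difference quotients along [h k = 1/(k+1)], which are
    measurable because translations are. This avoids relating the sigma-algebra generated by the
    coordinates to the topology. *)
Lemma measurable_derive n (f : R * 'rV[R]_n -> R) v : (forall z, derivable f z v) ->
  measurable_fun setT (f : measurableTypeR R * 'rV[R]_n -> R) ->
  measurable_fun setT (fun z : measurableTypeR R * 'rV[R]_n => 'D_v f z).
Proof.
move=> df mf; pose h (k : nat) : R := k.+1%:R^-1.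
have mshift (a : R * 'rV[R]_n) :
    measurable_fun setT (fun z : measurableTypeR R * 'rV[R]_n => f (a + z)).
  pose tr (z : measurableTypeR R * 'rV[R]_n) : measurableTypeR R * 'rV[R]_n :=
    ((a.1 : R) + z.1, a.2 + z.2).
  have mtr : measurable_fun setT tr.
    apply/measurable_fun_pairP; split.
      suff : measurable_fun setT (fun z : measurableTypeR R * 'rV[R]_n =>
        (a.1 : R) + (z.1 : R)) by [].
      by apply: measurable_funD => //; exact: (@measurable_comp_fst _ _ id).
    apply: measurable_fun_rV => j.
    rewrite (_ : (fun x => _) = fun z : measurableTypeR R * 'rV[R]_n =>
      a.2 ord0 j + z.2 ord0 j).
      by apply: measurable_funD => //; exact: measurable_coord2.
    by apply/funext => z; rewrite mxE.
  exact: (measurableT_comp mf mtr).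
apply: (@measurable_fun_cvg _ _ _ _ (fun k z => (h k)^-1 * (f (h k *: v + z) - f z))).
  by move=> k; apply: measurable_funM => //; apply: measurable_funB => //; exact: mshift.
move=> z _; have /cvgr_dnbhsP := df z; apply; split=> [k|]; last exact: cvg_harmonic.
by rewrite invr_eq0 pnatr_eq0.
Qed.

End derivatives.

(** * The test function *)

Section test_fun.
Context {R : realType}.
Variables (n : nat) (beta r rho : R) (l : nat).
Hypothesis r1 : 1 < r.
Let r0 : 0 < r. Proof. exact: lt_trans r1. Qed.
Notation E := 'rV[R]_n.

Definition cutoff (t : R) : R := step (2 - t / r).
(* The exponent [l.+2] leaves a factor [cutoff ^+ l] in the second derivative, which
   Hoelder's inequality absorbs into [zeta `^ q^-1] when [l.+2 / q <= l]. *)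
Definition zeta (t : R) : R := pos_id t `^ beta * cutoff t ^+ l.+2.
Definition chi (s : R) : R := step (rho + 1 - s) * step (rho + 1 + s).
Definition chin (x : E) : R := \prod_j chi (x ord0 j).
Definition tfun (z : R * E) : R := zeta z.1 * chin z.2.

Lemma cutoff_ge0 t : 0 <= cutoff t. Proof. exact: step_ge0. Qed.
Lemma cutoff_le1 t : cutoff t <= 1. Proof. exact: step_le1. Qed.
Lemma cutoff_eq1 t : t <= r -> cutoff t = 1.
Proof. by move=> tr; rewrite /cutoff step_ge1// lerBrDl -lerBrDr ler_pdivrMr//; lra. Qed.
Lemma cutoff_eq0 t : 2 * r <= t -> cutoff t = 0.
Proof. by move=> tr; rewrite /cutoff step_le0// subr_le0 ler_pdivlMr. Qed.

Lemma zeta_eq0 t : 2 * r <= t -> zeta t = 0.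
Proof. by move=> tr; rewrite /zeta cutoff_eq0// expr0n mulr0. Qed.

Lemma zetaE t : 1 / 2 <= t -> zeta t = t `^ beta * cutoff t ^+ l.+2.
Proof. by move=> tr; rewrite /zeta pos_idE. Qed.

Lemma zeta_ge0 t : 0 <= zeta t.
Proof. by rewrite mulr_ge0 ?powR_ge0 ?exprn_ge0 ?cutoff_ge0. Qed.

Lemma chin_eq1 x : cube rho x -> chin x = 1.
Proof.
move=> cx; rewrite /chin big1// => j _; have := cx j; rewrite ler_norml => /andP[x1 x2].
by rewrite /chi !step_ge1 ?mulr1//; lra.
Qed.

Lemma chin_neq0 x : chin x != 0 -> cube (rho + 1) x.
Proof.
move=> cx j; apply: contraNT cx; rewrite -ltNge ltr_normr => xj.
rewrite /chin (bigD1 j)//= [chi _](_ : _ = 0) ?mul0r// /chi.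
case/orP : xj => xj.
  by rewrite (@step_le0 _ (rho + 1 - x ord0 j)) ?mul0r//; lra.
by rewrite (@step_le0 _ (rho + 1 + x ord0 j)) ?mulr0//; lra.
Qed.

Lemma Ck_cutoff k : Ck k cutoff.
Proof.
apply: (@Ck_comp _ _ _ (fun t : R => 2 - t / r)); last exact: Ck_step.
rewrite (_ : (fun t => _) = fun t : R => 2 + (- r^-1) * t).
  by apply: CkD; [exact: Ck_cst|apply: CkM; [exact: Ck_cst|exact: Ck_id]].
by apply/funext => t; rewrite mulNr mulrC.
Qed.

Lemma Ck_zeta k : Ck k zeta.
Proof.
apply: CkM; last exact/CkX/Ck_cutoff.
by apply: Ck_powR; [exact: pos_id_gt0|exact: Ck_pos_id].
Qed.

Lemma Ck_chi k : Ck k chi.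
Proof.
apply: CkM.
  apply: (@Ck_comp _ _ _ (fun s : R => rho + 1 - s)); last exact: Ck_step.
  rewrite (_ : (fun t => _) = fun t : R => rho + 1 + (- 1) * t).
    by apply: CkD; [exact: Ck_cst|apply: CkM; [exact: Ck_cst|exact: Ck_id]].
  by apply/funext => t; rewrite mulN1r.
apply: (@Ck_comp _ _ _ (fun s : R => rho + 1 + s)); last exact: Ck_step.
by apply: CkD; [exact: Ck_cst|exact: Ck_id].
Qed.

Lemma Ck_tfun k : Ck k tfun.
Proof.
apply: CkM.
  by apply: (@Ck_comp _ _ _ (fun z : R * E => z.1)); [exact: Ck_fst|exact: Ck_zeta].
apply: (@Ck_prod _ _ _ _ _ (fun j (z : R * E) => chi (z.2 ord0 j))) => j.
by apply: (@Ck_comp _ _ _ (fun z : R * E => z.2 ord0 j));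
  [exact: Ck_coord_snd|exact: Ck_chi].
Qed.

Lemma test_tfun : test_function +oo%E tfun.
Proof.
(* [zeta] vanishes from time [2 * r] on, and [chin] vanishes off the cube of half-side [rho + 1]. *)
pose K : set (R * E) := `[1, 2 * r]%classic `*` cube (rho + 1).
have cK : compact K.
  apply: compact_setX; first exact: segment_compact.
  have := @rV_compact R n (fun=> `[- (rho + 1), rho + 1]%classic) (fun=>
    @segment_compact _ _ _).
  rewrite (_ : [set v | _] = cube (rho + 1))//; apply/seteqP; split=> x cx j.
    by have := cx j; rewrite /= in_itv/= -ler_norml.
  by rewrite /= in_itv/= -ler_norml; exact: cx.
have SK : closure [set z | 1 <= z.1 /\ tfun z != 0] `<=` K.
  have clK : closed K by apply: compact_closed cK; exact: norm_hausdorff.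
  rewrite [X in _ `<=` X]((closure_id K).1 clK).
  apply: closureS => z [z1 z0]; split; last first.
    by apply: chin_neq0; apply: contraNneq z0; rewrite /tfun => ->; rewrite mulr0.
  rewrite /= in_itv/= z1 /= leNgt; apply: contraNN z0 => z2.
  by rewrite /tfun zeta_eq0 ?mul0r// ltW.
split.
- by move=> k; exact: Ck_tfun.
- by apply: subclosed_compact cK SK; exact: closed_closure.
- by move=> z /SK [/=]; rewrite in_itv/= => /andP[z1 _] _; split=> //; split=> //;
  rewrite ltry.
Qed.

Lemma Ck_measurable (f : R -> R) : Ck 0 f -> measurable_fun setT f.
Proof. by move=> cf; apply: continuous_measurable_fun. Qed.

Lemma measurable_chin : measurable_fun setT chin.
Proof.
apply: (@measurable_prod _ E R setT 'I_n (index_enum _) (fun j (x : E) =>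
  chi (x ord0 j))) => j _.
apply: (measurableT_comp (Ck_measurable (Ck_chi 0))); exact: measurable_coord.
Qed.

Lemma measurable_tfun : measurable_fun setT (tfun : measurableTypeR R * E -> R).
Proof.
apply: measurable_funM.
  by apply: (@measurable_comp_fst R n zeta); exact: Ck_measurable (Ck_zeta 0).
exact: (measurableT_comp measurable_chin measurable_snd).
Qed.

End test_fun.

(** * The adjoint ordinary differential operator on the time factor *)

Section operator.
Context {R : realType}.

Definition step1 : R -> R := fun t => 'D_1 step t.
Definition step2 : R -> R := fun t => 'D_1 step1 t.

Lemma Ck_step1 k : Ck k step1.
Proof. by have [_ /(_ (1 : R)) []] := @Ck_step R k.+1. Qed.

Lemma Ck_step2 k : Ck k step2.
Proof. by have [_ /(_ (1 : R)) []] := Ck_step1 k.+1. Qed.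

Lemma is_derive_step (t : R) : is_derive t 1 step (step1 t).
Proof. by apply: derivableP; have [_ /(_ (1 : R)) []] := @Ck_step R 1. Qed.

Lemma is_derive_step1 (t : R) : is_derive t 1 step1 (step2 t).
Proof. by apply: derivableP; have [_ /(_ (1 : R)) []] := Ck_step1 1. Qed.

Lemma step1_out (t : R) : t < 0 \/ 1 < t -> step1 t = 0 /\ step2 t = 0.
Proof.
move=> H; have : \forall s \near t, s < 0 \/ 1 < s.
  case: H => H; first by near=> s; left; near: s; exact: lt_nbhsl.
  by near=> s; right; near: s; exact: lt_nbhsr.
move=> ns; have out s : s < 0 \/ 1 < s -> step1 s = 0.
  case=> s0; rewrite /step1.
    rewrite (@near_eq_derive R R R _ (cst 0)) ?derive_cst//.
    by near=> u; rewrite step_le0// ltW//; near: u; exact: lt_nbhsl.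
  rewrite (@near_eq_derive R R R _ (cst 1)) ?derive_cst//.
  by near=> u; rewrite step_ge1// ltW//; near: u; exact: lt_nbhsr.
split; first exact: out.
rewrite /step2 (@near_eq_derive R R R _ (cst 0)) ?derive_cst//.
by apply: filterS ns => s; exact: out.
Unshelve. all: by end_near. Qed.

Lemma step_derivatives_bounded :
  exists2 B : R, 0 <= B & forall t, `|step1 t| <= B /\ `|step2 t| <= B.
Proof.
have bnd (f : R -> R) : continuous f -> exists B, forall t, t \in `[0, 1]%R -> `|f t| <= B.
  move=> cf; have /(@EVT_max R _ 0 1 ler01) [c _ cP] :
    {within `[0, 1], continuous (fun x => `|f x|)}.
    by apply: continuous_subspaceT => x; apply: continuous_comp;
      [exact: cf|exact: norm_continuous].
  by exists (`|f c|).
have [B1 H1] := bnd _ (Ck_continuous (Ck_step1 0)).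
have [B2 H2] := bnd _ (Ck_continuous (Ck_step2 0)).
have B10 : 0 <= B1 by apply: le_trans (H1 0 _); rewrite ?in_itv/= ?lexx ?ler01.
have B20 : 0 <= B2 by apply: le_trans (H2 0 _); rewrite ?in_itv/= ?lexx ?ler01.
exists (B1 + B2); first exact: addr_ge0.
move=> t; have [t0|t0] := ltP t 0.
  by have [-> ->] := step1_out (or_introl t0); rewrite normr0 addr_ge0.
have [t1|t1] := ltP 1 t.
  by have [-> ->] := step1_out (or_intror t1); rewrite normr0 addr_ge0.
have tI : t \in `[0, 1]%R by rewrite in_itv/= t0.
by split; [apply: le_trans (H1 t tI) _; rewrite lerDl|apply: le_trans (H2 t tI) _;
  rewrite lerDr].
Qed.

(** The power is kept as a common factor, so that repeated differentiation only acts on the bracket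
    and all terms can be compared. *)
Lemma is_derive_powRM (b t : R) (P : R -> R) (dP : R) : 0 < t ->
  is_derive t 1 P dP ->
  is_derive t 1 (fun s => s `^ b * P s) (t `^ b * (dP + b * P t / t)).
Proof.
move=> t0 DP; have H := is_deriveM (is_derive1_powR b t0) DP.
apply: is_derive_eq H _; rewrite /GRing.scale /= powRB ?powRr1 ?(ltW t0)//; last first.
  by apply/implyP => _; rewrite gt_eqF.
by field; rewrite gt_eqF.
Qed.

Section fixed.
Variables (n : nat) (beta r : R) (l : nat).
Hypothesis r1 : 1 < r.
Let r0 : 0 < r. Proof. exact: lt_trans r1. Qed.
Local Notation zeta := (zeta beta r l).
Local Notation cutoff := (cutoff r).

(** [cutoffX1] and [cutoffX2] are the first two derivatives of [cutoff ^+ l.+2]. Both retain a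
    factor [cutoff ^+ l] and contain a derivative of [step], hence live on the shell. *)
Definition cutoffX1 (t : R) : R := - (l.+2%:R / r) * (cutoff t ^+ l.+1 * step1 (2 - t / r)).
Definition cutoffX2 (t : R) : R := l.+2%:R / r ^+ 2 *
  (l.+1%:R * cutoff t ^+ l * step1 (2 - t / r) ^+ 2 + cutoff t ^+ l.+1 * step2 (2 - t / r)).

Lemma is_derive_arg (t : R) : is_derive t 1 (fun t : R => 2 - t / r) (- r^-1).
Proof.
rewrite (_ : (fun t => _) = (cst 2 - (r^-1 *: @id R))%R); last first.
  by apply/funext => s /=; rewrite mulrC.
have H := is_deriveB (is_derive_cst (2 :
  R) t 1) (is_deriveZ (r^-1)%R (is_derive_id t (1 : R))).
by apply: is_derive_eq H _; rewrite sub0r [_ *: 1]mulr1.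
Qed.

Lemma is_derive_stepX k (t : R) :
  is_derive t 1 (fun t =>
    cutoff t ^+ k.+1) (- (k.+1%:R / r) * (cutoff t ^+ k * step1 (2 - t / r))).
Proof.
have D : is_derive t 1 cutoff (step1 (2 - t / r) * - r^-1).
  by apply: is_derive1_comp (is_derive_arg t); exact: is_derive_step.
have H := is_deriveX k.+1 D; rewrite exprfctE in H; apply: is_derive_eq H _.
by rewrite /GRing.scale /=; ring.
Qed.

Lemma is_derive_cutoffX1 (t : R) : is_derive t 1 cutoffX1 (cutoffX2 t).
Proof.
have D1 : is_derive t 1 (fun t => step1 (2 - t / r)) (step2 (2 - t / r) * - r^-1).
  by apply: is_derive1_comp (is_derive_arg t); exact: is_derive_step1.
have H := is_deriveZ (- (l.+2%:R / r)) (is_deriveM (is_derive_stepX l t) D1).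
apply: is_derive_eq H _; rewrite /cutoffX2 /GRing.scale /=; field.
by rewrite gt_eqF.
Qed.

Lemma near_half (t : R) : 1 <= t -> \forall s \near t, 1 / 2 < s.
Proof. by move=> t1; near=> s; near: s; apply: lt_nbhsr; lra.
Unshelve. all: by end_near. Qed.

(** The open range [1 / 2 < t] contains a neighbourhood of every [t >= 1], the initial time
    included, so the formula can be differentiated again. *)
Lemma is_derive_zeta (t : R) : 1 / 2 < t ->
  is_derive t 1 zeta (t `^ beta * (cutoffX1 t + beta * cutoff t ^+ l.+2 / t)).
Proof.
move=> t0.
apply: (@near_eq_is_derive R R R (fun s => s `^ beta * cutoff s ^+ l.+2)).
  by near=> s; rewrite zetaE// ltW//; near: s; exact: lt_nbhsr.
by apply: is_derive_powRM; [lra|exact: is_derive_stepX].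
Unshelve. all: by end_near. Qed.

Lemma derive2_zeta (t : R) : 1 <= t -> is_derive t 1 ('D_1 zeta)
  (t `^ beta * (cutoffX2 t + 2 * beta * cutoffX1 t / t
     + beta * (beta - 1) * cutoff t ^+ l.+2 / t ^+ 2)).
Proof.
move=> t1; have t0 : 0 < t by lra.
have tn0 : t != 0 by rewrite gt_eqF.
apply: (@near_eq_is_derive R R R
  (fun s => s `^ beta * (cutoffX1 s + beta * cutoff s ^+ l.+2 / s))).
  near=> s; have s0 : 1 / 2 < s by near: s; exact: near_half.
  by have [_ ->] := is_derive_zeta s0.
have DX : is_derive t 1 (fun s : R => s^-1) (- t ^- 2).
  by apply: is_derive_eq (is_deriveV tn0 (is_derive_id t 1)) _; rewrite [LHS]mulr1.
have D : is_derive t 1 (fun s => cutoffX1 s + beta * cutoff s ^+ l.+2 / s) _ :=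
  is_deriveD (is_derive_cutoffX1 t)
    (is_deriveM (is_deriveZ beta (is_derive_stepX l.+1 t)) DX).
apply: is_derive_eq (is_derive_powRM beta t0 D) _.
rewrite /GRing.scale /= /cutoffX1 /GRing.scale /=.
by field; rewrite ?tn0 ?gt_eqF.
Unshelve. all: by end_near. Qed.

Lemma derive_damping (mu t : R) : 1 <= t -> is_derive t 1 (fun s => mu / s * zeta s)
  (t `^ beta * (mu * cutoffX1 t / t + mu * (beta - 1) * cutoff t ^+ l.+2 / t ^+ 2)).
Proof.
move=> t1; have t0 : 0 < t by lra.
have tn0 : t != 0 by rewrite gt_eqF.
have DX : is_derive t 1 (fun s : R => s^-1) (- t ^- 2).
  by apply: is_derive_eq (is_deriveV tn0 (is_derive_id t 1)) _; rewrite [LHS]mulr1.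
have Dz : is_derive t 1 zeta (t `^ beta * (cutoffX1 t + beta * cutoff t ^+ l.+2 / t)).
  by apply: is_derive_zeta; lra.
have D : is_derive t 1 (fun s => mu / s * zeta s) _ := is_deriveM (is_deriveZ mu DX) Dz.
apply: is_derive_eq D _.
rewrite /GRing.scale /= /GRing.scale /= zetaE; last lra.
by field.
Qed.

(** The adjoint of [w'' + (mu/t) w' + (nu^2/t^2) w], applied to [zeta]: what is left of the weak
    operator once the Laplacian vanishes. *)
Definition timeop (mu nu : R) (t : R) : R :=
  'D_1 ('D_1 zeta) t - 'D_1 (fun s : R => mu / s * zeta s) t + nu ^+ 2 / t ^+ 2 * zeta t.

(** The first hypothesis is the indicial equation of the adjoint for [t^beta]. It says that the
    coefficient of the undifferentiated term [cutoff ^+ l.+2 / t ^+ 2], namely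
    [beta (beta - 1) - mu (beta - 1) + nu^2], is zero. *)
Lemma timeopE (mu nu t : R) :
  beta ^+ 2 - (mu + 1) * beta + mu + nu ^+ 2 = 0 -> 1 <= t ->
  timeop mu nu t = t `^ beta * (cutoffX2 t + (2 * beta - mu) * cutoffX1 t / t).
Proof.
move=> root t1; have t0 : 0 < t by lra.
have tn0 : t != 0 by rewrite gt_eqF.
rewrite /timeop; have [_ ->] := derive2_zeta t1; have [_ ->] := derive_damping mu t1.
rewrite zetaE; last lra.
have -> : nu ^+ 2 = - (beta ^+ 2 - (mu + 1) * beta + mu) by lra.
by field.
Qed.

(** Off the shell the derivatives of [step] vanish. On it [r / t <= 1], so [cutoffX1 t / t], of size
    [1 / (r t)], is of the same order [r^-2] as [cutoffX2 t]. *)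
Lemma timeop_bound (mu nu B t : R) : 0 <= B ->
  (forall t, `|step1 t| <= B /\ `|step2 t| <= B) ->
  beta ^+ 2 - (mu + 1) * beta + mu + nu ^+ 2 = 0 -> 1 <= t ->
  `|timeop mu nu t| <=
    l.+2%:R * (l.+1%:R * B ^+ 2 + B + `|2 * beta - mu| * B) / r ^+ 2
    * (t `^ beta * cutoff t ^+ l) * (r <= t <= 2 * r)%R%:R.
Proof.
move=> B0 HB root t1; rewrite timeopE//.
have [tr|tr] := boolP (r <= t <= 2 * r); last first.
  have out : 2 - t / r < 0 \/ 1 < 2 - t / r.
    move: tr; rewrite negb_and -!ltNge => /orP[tr|tr]; [right|left].
      by rewrite ltrBrDl -ltrBrDr ltr_pdivrMr//; lra.
    by rewrite subr_lt0 ltr_pdivlMr.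
  have [s1 s2] := step1_out out.
  by rewrite /cutoffX1 /cutoffX2 s1 s2 expr0n !mulr0 addr0 !mulr0 mul0r addr0 mulr0 normr0.
rewrite mulr1; have /andP[rt tr2] := tr.
have t0 : 0 < t by lra.
have [b1 b2] := HB (2 - t / r).
have c0 := cutoff_ge0 r t; have c1 := cutoff_le1 r t.
set c := cutoff t in c0 c1 *; set s1 := step1 _ in b1 *; set s2 := step2 _ in b2 *.
have -> : cutoffX2 t + (2 * beta - mu) * cutoffX1 t / t = l.+2%:R / r ^+ 2 * c ^+ l *
    (l.+1%:R * s1 ^+ 2 + c * s2 - (2 * beta - mu) * (c * s1 * (r / t))).
  rewrite /cutoffX2 /cutoffX1 -/c -/s1 -/s2 !exprS; field.
  by rewrite !gt_eqF.
have cB (x : R) : `|x| <= B -> `|c * x| <= B.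
  by move=> xB; rewrite normrM ger0_norm//; apply: le_trans xB; rewrite ler_piMl.
have rt1 : `|r / t| <= 1.
  by rewrite ger0_norm; [rewrite ler_pdivrMr// mul1r|rewrite divr_ge0// ltW].
have H : `|l.+1%:R * s1 ^+ 2 + c * s2 - (2 * beta - mu) * (c * s1 * (r / t))| <=
    l.+1%:R * B ^+ 2 + B + `|2 * beta - mu| * B.
  apply: le_trans (ler_normB _ _) _; apply: lerD.
    apply: le_trans (ler_normD _ _) _; apply: lerD; last exact: cB.
    rewrite normrM normr_nat ler_wpM2l// normrX.
    by rewrite lerXn2r// nnegrE.
  rewrite normrM ler_wpM2l// normrM -[leRHS]mulr1 ler_pM//; exact: cB.
have Lr : 0 <= l.+2%:R / r ^+ 2 by rewrite divr_ge0// exprn_ge0// ltW.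
have A0 : 0 <= l.+2%:R / r ^+ 2 * c ^+ l by rewrite mulr_ge0// exprn_ge0.
rewrite normrM (ger0_norm (powR_ge0 _ _)) normrM (ger0_norm A0).
rewrite (_ : _ * (t `^ beta * c ^+ l) = t `^ beta *
  (l.+2%:R / r ^+ 2 * c ^+ l * (l.+1%:R * B ^+ 2 + B + `|2 * beta - mu| * B))); last first.
  by field; rewrite gt_eqF.
apply: ler_wpM2l; first exact: powR_ge0.
exact: ler_wpM2l.
Qed.

End fixed.
End operator.

(** * The weak operator on the test function *)

Section weak_operator.
Context {R : realType} {n : nat}.
Notation E := 'rV[R]_n.

(** Spelled exactly as the factor of [w] in [weak_solution], so that the two agree by conversion. *)
Definition weakop (m mu nu : R) (Phi : R * E -> R) (z : R * E) : R :=
  dt (dt Phi) z - z.1 `^ (2 * m) * laplacian Phi z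
  - dt (fun y => mu / y.1 * Phi y) z + nu ^+ 2 / z.1 ^+ 2 * Phi z.

Variables (beta r rho : R) (l : nat).
Hypothesis r1 : 1 < r.
Let r0 : 0 < r. Proof. exact: lt_trans r1. Qed.
Local Notation zeta := (zeta beta r l).
Local Notation Phi := (@tfun R n beta r rho l).

Lemma derivable_zeta t : derivable zeta t 1.
Proof. by have [_ /(_ (1 : R)) []] := Ck_zeta beta r l 1. Qed.

Lemma derivable_zeta1 (t : R) : derivable ('D_1 zeta) t 1.
Proof. by have [_ /(_ (1 : R)) [_ [_ /(_ (1 : R)) []]]] := Ck_zeta beta r l 2. Qed.

Lemma dt_tfun : dt Phi = (fun z => 'D_1 zeta z.1 * chin rho z.2).
Proof. by apply/funext => z; rewrite dt_sep//; exact: derivable_zeta. Qed.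

(** The strict inequality yields a neighbourhood on which [chin] is [1] and [Phi] depends on time
    only; after [2 * r] the factor [zeta] vanishes along the whole slice. *)
Lemma laplacian_tfun0 (z : R * E) : (z.1 <= 2 * r -> forall j, `|z.2 ord0 j| < rho) ->
  laplacian Phi z = 0.
Proof.
move=> zr; rewrite /laplacian big1// => j _.
have [z1|z1] := leP z.1 (2 * r); last first.
  have Z (y : R * E) : y.1 = z.1 -> 'D_(0, basis_rV R j) Phi y = 0.
    move=> yz; apply: derive_line_cst => h.
    by rewrite /tfun /= scaler0 add0r yz zeta_eq0 ?mul0r// ltW.
  apply: derive_line_cst => h; rewrite !Z//=.
  by rewrite scaler0 add0r.
have near_rho (y : R * E) : (forall i, `|y.2 ord0 i| < rho) ->
    \forall u \near y, forall i, `|(u : R * E).2 ord0 i| < rho.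
  move=> yr; apply: (@filter_forall (R * E)%type 'I_n (fun i =>
    [set u : R * E | `|u.2 ord0 i| < rho]) (nbhs y)) => i.
  have C : {for y, continuous (fun u : R * E => `|u.2 ord0 i|)}.
    by apply: continuous_comp; [exact: continuous_coord_snd|exact: norm_continuous].
  exact: (C _ (lt_nbhsl (yr i))).
have Z (y : R * E) : (forall i, `|y.2 ord0 i| < rho) -> 'D_(0, basis_rV R j) Phi y = 0.
  move=> yr; rewrite (@near_eq_derive R (R * E)%type R _ (fun u : R * E => zeta u.1)).
    by apply: derive_line_cst => h /=; rewrite scaler0 add0r.
  near=> u; rewrite /tfun chin_eq1 ?mulr1// => i; apply/ltW.
  by move: i; near: u; exact: near_rho.
rewrite (@near_eq_derive R (R * E)%type R _ (cst 0)); first exact: derive_cst.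
by apply: filterS (near_rho _ (zr z1)) => y /Z.
Unshelve. all: by end_near. Qed.

Lemma zeta_near0 (t : R) : 2 * r < t -> \forall s \near t, zeta s = 0.
Proof.
by move=> tr; near=> s; rewrite zeta_eq0// ltW//; near: s; exact: lt_nbhsr.
Unshelve. all: by end_near. Qed.

Lemma timeop_eq0 (mu nu t : R) : 2 * r < t -> timeop beta r l mu nu t = 0.
Proof.
move=> tr; rewrite /timeop.
have D s : 2 * r < s -> 'D_1 zeta s = 0.
  move=> sr; rewrite (@near_eq_derive R R R _ (cst 0)) ?derive_cst//.
  exact: zeta_near0.
rewrite (@near_eq_derive R R R ('D_1 zeta) (cst 0)); last first.
  by near=> s; rewrite D//; near: s; exact: lt_nbhsr.
rewrite (@near_eq_derive R R R _ (cst 0)); last first.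
  by apply: filterS (zeta_near0 tr) => s ->; rewrite mulr0.
by rewrite !derive_cst zeta_eq0 ?mulr0 ?addr0 ?subr0// ltW.
Unshelve. all: by end_near. Qed.

Lemma weakop_tfun (m mu nu : R) (z : R * E) : 1 <= z.1 ->
  (z.1 <= 2 * r -> forall j, `|z.2 ord0 j| < rho) ->
  weakop m mu nu Phi z = timeop beta r l mu nu z.1.
Proof.
move=> z1 zr; rewrite /weakop laplacian_tfun0// mulr0 subr0.
rewrite dt_tfun (@dt_sep _ _ ('D_1 zeta)); last exact: derivable_zeta1.
rewrite (_ : (fun y : R * E => mu / y.1 * Phi y) =
   fun y => (fun s => mu / s * zeta s) y.1 * chin rho y.2); last first.
  by apply/funext => y; rewrite /= mulrA.
rewrite (@dt_sep _ _ (fun s : R => mu / s * zeta s) (chin rho) z); last first.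
  by have [] := derive_damping beta r l mu z1.
rewrite /tfun mulrA -mulrBl -mulrDl -/(timeop beta r l mu nu z.1).
have [z2|z2] := leP z.1 (2 * r); last by rewrite timeop_eq0// mul0r.
by rewrite chin_eq1 ?mulr1// => j; exact/ltW/zr.
Qed.

(** As [1 < r], the cutoff is inactive at the initial time, where the time factor behaves like
    [t^beta]. Together with [tfun1] this determines the data term of the weak form. *)
Lemma dt_tfun1 x : dt Phi (1, x) = beta * chin rho x.
Proof.
rewrite dt_tfun /=; congr (_ * _).
have h1 : 1 / 2 < 1 :> R by lra.
have [_ ->] := is_derive_zeta beta r l h1.
have [s1 _] : step1 (2 - 1 / r) = 0 /\ step2 (2 - 1 / r) = 0.
  have rV : 1 / r < 1 by rewrite ltr_pdivrMr// mul1r.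
  by apply: step1_out; right; lra.
rewrite /cutoffX1 s1 cutoff_eq1 ?(ltW r1)// powR1 expr1n.
by rewrite !mulr0 add0r mul1r expr1n mulr1 divr1.
Qed.

Lemma tfun1 x : Phi (1, x) = chin rho x.
Proof.
by rewrite /tfun /= zetaE ?cutoff_eq1 ?(ltW r1)// ?powR1 ?expr1n ?mul1r//; lra.
Qed.

Lemma measurable_weakop (m mu nu : R) :
  measurable_fun (slab +oo%E) (weakop m mu nu Phi : measurableTypeR R * E -> R).
Proof.
have CP k : Ck k Phi by exact: Ck_tfun.
have mP : measurable_fun setT (Phi : measurableTypeR R * E -> R) by exact: measurable_tfun.
have mD v : measurable_fun setT (fun z : measurableTypeR R * E => 'D_v Phi z).
  by apply: measurable_derive mP => z; have [_ /(_ v) []] := CP 1.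
have mDD v : measurable_fun setT (fun z : measurableTypeR R * E => 'D_v ('D_v Phi) z).
  by apply: measurable_derive (mD v) => z; have [_ /(_ v) [_ [_ /(_ v) []]]] := CP 2.
have mpow b : measurable_fun setT (fun z : measurableTypeR R * E => z.1 `^ b).
  by apply: (@measurable_comp_fst R n (fun t => t `^ b)); exact: measurable_powR.
(* The damping term is expanded by the product rule and divisions by time become powers, so that
   every factor is measurable on the whole space; the two expressions are compared only where
   [1 <= z.1]. *)
apply: (@eq_measurable_fun _ _ _ _ _ (fun z : measurableTypeR R * E =>
   dt (dt Phi) z - z.1 `^ (2 * m) * laplacian Phi z
  - (mu * z.1 `^ (-1) * dt Phi z - mu * z.1 `^ (-2) * Phi z) + nu ^+ 2 * z.1 `^ (-2)
    * Phi z)).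
  move=> z; rewrite inE => -[[z1 _] _]; rewrite /weakop.
  have z0 : (0 : R) < z.1 by apply: lt_le_trans z1.
  rewrite (_ : (fun y : R * E => mu / y.1 * Phi y) =
     fun y => (fun s => mu / s * zeta s) y.1 * chin rho y.2); last first.
    by apply/funext => y; rewrite /= mulrA.
  have [D1 D2] := derive_damping beta r l mu z1.
  rewrite (@dt_sep _ _ (fun s : R => mu / s * zeta s) (chin rho) z D1) D2 dt_tfun.
  have h1 : 1 / 2 < z.1 by apply: lt_le_trans z1; lra.
  have [_ ->] := is_derive_zeta beta r l h1.
  rewrite /tfun zetaE ?ltW// !powRN powRr1 ?ltW// powR_mulrn ?ltW//.
  by field; rewrite gt_eqF.
apply: measurable_funS measurableT _ _ => //.
apply: measurable_funD; last by apply: measurable_funM; [apply: measurable_funM => //;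
  exact: mpow|exact: mP].
apply: measurable_funB.
  apply: measurable_funB; first exact: mDD.
  apply: measurable_funM; first exact: mpow.
  by apply: measurable_sum => j; exact: mDD.
apply: measurable_funB; apply: measurable_funM; rewrite -?/(dt _) //;
  first [exact: mP|exact: mD|apply: measurable_funM => //; exact: mpow].
Qed.

End weak_operator.

(** * Positivity of the data functional *)

Section data.
Context {R : realType} {n : nat}.
Notation E := 'rV[R]_n.
Notation leb := (lebesgue_rV R n).

Lemma Lfun1_measurable (f : E -> R) : f \in Lfun leb 1 -> measurable_fun setT f.
Proof. by move=> /sub_Lfun_mfun; rewrite inE. Qed.

Lemma measurable_enorm_lt (s : R) : measurable [set x : E | enorm x < s].
Proof. by apply: measurable_ltr; [exact: measurable_enorm|exact: measurable_cst]. Qed.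

Lemma ball_integralE (f : E -> R) (M s : R) : measurable_fun setT f ->
  {ae leb, forall x, ~ eball M x -> f x = 0} -> M < s ->
  (\int[leb]_(x in [set x | (enorm x < s)%R]) (f x)%:E = \int[leb]_x (f x)%:E)%E.
Proof.
move=> mf f0 Ms; rewrite integral_mkcond.
apply: ae_eq_integral => //.
- have := measurable_restrictT (EFin \o f) (measurable_enorm_lt s).
  by move=> [H _]; apply: H; apply: measurable_funTS; exact/measurable_EFinP.
- exact/measurable_EFinP.
- apply: filterS f0 => x fx _; rewrite patchE; case: ifPn => //.
  rewrite notin_setE /= => nx; rewrite fx//= => Mx; apply: nx.
  exact: le_lt_trans Ms.
Qed.

(** Ball integrals of radius greater than [M] all equal the full integral. The lower limit is a
    supremum of infima, so some set [V] of radii has positive infimum, and [V] contains a radius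
    beyond [M]. *)
Lemma liminf_ball_gt0 (f : E -> R) (M : R) : measurable_fun setT f ->
  {ae leb, forall x, ~ eball M x -> f x = 0} ->
  (0 < liminf_ball_integral f)%E -> (0 < \int[leb]_x (f x)%:E)%E.
Proof.
move=> mf f0; rewrite /liminf_ball_integral limf_einfE => /ereal_sup_gt[_ [V FV <-] H].
have [s [Vs Ms]] : exists s, V s /\ M < s.
  have : \forall s \near +oo, V s /\ M < s.
    by apply: filterI => //; by apply: nbhs_pinfty_gt; exact: num_real.
  by move=> /filter_ex.
rewrite -(ball_integralE mf f0 Ms); apply: lt_le_trans H _.
by apply: ereal_inf_lbound; exists s.
Qed.

End data.

(** * The weak form against the test function *)

Section weak_form.
Context {R : realType} {n : nat}.
Notation E := 'rV[R]_n.
Notation leb := (lebesgue_rV R n).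
Notation st := (lebesgue_spacetime R n).
Notation ST := (measurableTypeR R * E)%type.
Notation slaby := (slab +oo%E : set ST).

Variables (m mu nu beta p M : R) (w0 w1 : E -> R) (w v : R -> E -> R) (rhoL : R -> R).
Hypothesis p0 : p != 0.
Hypothesis mrho : measurable_fun setT rhoL.
Hypothesis mw : measurable_fun slaby (fun z => w z.1 z.2).
Hypothesis mv : measurable_fun slaby (fun z => v z.1 z.2).
Hypothesis sw : forall t, 1 < t -> {ae leb, forall x, ~ cube (rhoL t) x -> w t x = 0}.
Hypothesis sv : forall t, 1 < t -> {ae leb, forall x, ~ cube (rhoL t) x -> v t x = 0}.
Hypothesis w0L : w0 \in Lfun leb 1.
Hypothesis w1L : w1 \in Lfun leb 1.
Hypothesis w0s : {ae leb, forall x, ~ eball M x -> w0 x = 0}.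
Hypothesis w1s : {ae leb, forall x, ~ eball M x -> w1 x = 0}.
Hypothesis weak : weak_solution m mu nu +oo%E w0 w1 w (fun t x => `|v t x| `^ p).

Local Notation W := (trunc rhoL w).
Local Notation V := (trunc rhoL v).

Variables (r rho : R) (l : nat).
Hypothesis r1 : 1 < r.
Hypothesis rhoM : M <= rho.
Hypothesis rhoP : forall t, 1 <= t -> t <= 2 * r -> rhoL t < rho.

Lemma slab_ge1 (z : ST) : slaby z -> (1 : R) <= z.1.
Proof. by move=> [[]]. Qed.

(** Where [W] is nonzero the point lies in the cone, which up to time [2 * r] stays inside the open
    cube of half-side [rho]. *)
Lemma trunc_weakop (z : ST) : slaby z ->
  W z * weakop m mu nu (@tfun R n beta r rho l) z = W z * timeop beta r l mu nu z.1.
Proof.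
move=> /slab_ge1 z1; have [->|/trunc_neq0 [_ zc]] := eqVneq (W z) 0;
  first by rewrite !mul0r.
rewrite weakop_tfun// => z2 j; exact: le_lt_trans (zc j) (rhoP z1 z2).
Qed.

Lemma measurable_trunc_timeop :
  measurable_fun slaby (fun z => W z * timeop beta r l mu nu z.1).
Proof.
apply: (eq_measurable_fun (fun z => W z * weakop m mu nu (@tfun R n beta r rho l) z)).
  by move=> z; rewrite inE; exact: trunc_weakop.
apply: measurable_funM; first by apply: measurable_funTS; exact: measurable_trunc.
exact: measurable_weakop.
Qed.

(** The spatial cutoff disappears because it equals [1] wherever the data, or the truncated
    solutions up to time [2 * r], are nonzero. *)
Lemma weak_identity :
  (\int[st]_(z in slaby) (W z * timeop beta r l mu nu z.1)%:E
   = \int[leb]_x ((mu - beta) * w0 x + w1 x)%:E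
     + \int[st]_(z in slaby) (`|V z| `^ p * zeta beta r l z.1)%:E)%E.
Proof.
have tst := @test_tfun R n beta r rho l r1.
have := weak tst.
have mT : measurable_fun setT (@tfun R n beta r rho l : ST -> R) by exact: measurable_tfun.
have mW := measurable_trunc mrho mw; have mV := measurable_trunc mrho mv.
have mwk := @measurable_weakop R n beta r rho l m mu nu.
have mS := @measurable_slab R n.
have -> : (\int[lebesgue_spacetime R n]_(z in slab +oo%E)
   (w z.1 z.2 * weakop m mu nu (@tfun R n beta r rho l) z)%:E)%E =
   (\int[st]_(z in slaby) (W z * timeop beta r l mu nu z.1)%:E)%E.
  transitivity (\int[st]_(z in slaby) (W z * weakop m mu nu (@tfun R n beta r rho l)
    z)%:E)%E.
    apply: ae_eq_integral => //.
    - by apply/measurable_EFinP; exact: measurable_funM.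
    - by apply/measurable_EFinP; apply: measurable_funM => //; exact: measurable_funTS.
    - by apply: (@filterS _ _ (ae_filter_ringOfSetsType st) _ _ _ (trunc_ae mrho mw sw))
      => z wz sz; rewrite wz.
  by apply: eq_integral => z; rewrite inE => sz; rewrite trunc_weakop.
have -> : (\int[lebesgue_rV R n]_x
     (- (w0 x * dt (@tfun R n beta r rho l) (1, x)) +
      (mu * w0 x + w1 x) * @tfun R n beta r rho l (1, x))%:E =
    \int[leb]_x ((mu - beta) * w0 x + w1 x)%:E)%E.
  have m0 := Lfun1_measurable w0L; have m1 := Lfun1_measurable w1L.
  have mc := @measurable_chin R n rho.
  transitivity (\int[leb]_x (((mu - beta) * w0 x + w1 x) * chin rho x)%:E)%E.
    apply: eq_integral => x _; congr _%:E; rewrite dt_tfun1// tfun1//; ring.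
  apply: ae_eq_integral => //.
  - by apply/measurable_EFinP; apply: measurable_funM => //;
    apply: measurable_funD => //; exact: measurable_funM.
  - by apply/measurable_EFinP; apply: measurable_funD => //; exact: measurable_funM.
  - apply: filterS2 w0s w1s => x h0 h1 _; congr _%:E.
    have [xM|xM] := pselect (eball M x); last by rewrite h0// h1// mulr0 add0r mul0r.
    rewrite chin_eq1 ?mulr1// => j; apply: le_trans rhoM; exact: eball_cube.
have -> : (\int[lebesgue_spacetime R n]_(z in slab +oo%E)
     (`|v z.1 z.2| `^ p * @tfun R n beta r rho l z)%:E)%E =
   (\int[st]_(z in slaby) (`|V z| `^ p * zeta beta r l z.1)%:E)%E.
  apply: ae_eq_integral => //.
  - apply/measurable_EFinP; apply: measurable_funM; last exact: measurable_funTS.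
    apply: (measurableT_comp (measurable_powR p)); exact: measurableT_comp.
  - apply/measurable_EFinP; apply: measurable_funTS; apply: measurable_funM.
      exact: measurable_norm_powR.
    apply: (@measurable_comp_fst R n (zeta beta r l)).
    exact: Ck_measurable (Ck_zeta beta r l 0).
  - apply: (@filterS _ _ (ae_filter_ringOfSetsType st) _ _ _ (trunc_ae mrho mv sv)) =>
    z vz sz; congr _%:E.
    (* The zero case relies on [p != 0], as the power of [0] with exponent [0] is [1]. *)
    rewrite vz// /tfun; have [->|/trunc_neq0 [_ zc]] := eqVneq (V z) 0.
      by rewrite normr0 powR0// !mul0r.
    have [z2|z2] := leP (z.1 : R) (2 * r); last by rewrite zeta_eq0 ?mul0r ?mulr0// ltW.
    rewrite chin_eq1 ?mulr1// => j; apply: le_trans (zc j) _; apply/ltW/rhoP => //.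
    exact: slab_ge1.
by [].
Qed.

End weak_form.

(** * Estimates on the shell [r <= t <= 2r] *)

Section powers.
Context {R : realType}.

(** The ratio [t / r] lies between [1] and [2]; the absolute value of [s] covers negative
    exponents. *)
Lemma powR_dyadic_le (s r t : R) : 0 < r -> r <= t <= 2 * r ->
  t `^ s <= 2 `^ `|s| * r `^ s.
Proof.
move=> r0 /andP[rt tr].
have -> : t = (t / r) * r by rewrite divfK// gt_eqF.
have x1 : 1 <= t / r by rewrite ler_pdivlMr// mul1r.
have x2 : t / r <= 2 by rewrite ler_pdivrMr.
rewrite powRM ?ler_wpM2r ?powR_ge0// ?(ltW r0)//; last by rewrite (le_trans ler01).
apply: (@le_trans _ _ ((t / r) `^ `|s|)); first by apply: ler_powR => //; exact: ler_norm.
by apply: ge0_ler_powR; rewrite ?nnegrE//; rewrite (le_trans ler01).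
Qed.

(** For [c] in [(0, 1]] a smaller exponent gives a larger power. The condition on [l] excludes
    [l = 0], so [c = 0] causes no trouble. *)
Lemma expr_le_powR (c q : R) (l : nat) : 0 <= c <= 1 -> 1 < q -> l.+2%:R / q <= l%:R ->
  c ^+ l <= (c ^+ l.+2) `^ q^-1.
Proof.
move=> /andP[c0 c1] q1 lq; have q0 : 0 < q := lt_trans ltr01 q1.
case: l lq => [|l] lq.
  by move: lq; rewrite ler_pdivrMr// mul0r lern0.
have [->|cn0] := eqVneq c 0; first by rewrite expr0n powR_ge0.
rewrite -!powR_mulrn// -powRrM; apply: ger_powR => //.
by rewrite lt_neqAle eq_sym cn0 c0.
Qed.

End powers.

Section shell.
Context {R : realType} {n : nat}.
Notation E := 'rV[R]_n.
Notation leb := (lebesgue_rV R n).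
Notation st := (lebesgue_spacetime R n).
Notation ST := (measurableTypeR R * E)%type.

Definition shell (r rho : R) : set ST := [set z | r <= z.1 <= 2 * r /\ cube rho z.2].

Lemma shellE r rho : shell r rho = `[r, 2 * r]%classic `*` cube rho.
Proof. by apply/seteqP; split=> -[t x] /= []; rewrite ?in_itv /=. Qed.

Lemma measurable_shell r rho : measurable (shell r rho).
Proof. by rewrite shellE; apply: measurableX => //; exact: measurable_cube. Qed.

Lemma shell_measure r rho : 0 <= r -> 0 <= rho ->
  (st (shell r rho) <= (r * (2 * rho) ^+ n)%:E)%E.
Proof.
move=> r0 rho0; rewrite shellE /lebesgue_spacetime.
rewrite [leLHS]product_measure1E//; last exact: measurable_cube.
rewrite EFinM; apply: lee_pmul;
  [exact: measure_ge0|exact: measure_ge0| |exact: lebesgue_rV_cube].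
pose I : interval R := `[r, 2 * r].
suff : (@lebesgue_measure R [set` I] <= r%:E)%E by [].
rewrite lebesgue_measure_itv/= lte_fin; case: ifP => _; last by rewrite lee_fin.
by rewrite -EFinD lee_fin; lra.
Qed.

End shell.

Section key_estimate.
Context {R : realType} {n : nat}.
Notation E := 'rV[R]_n.
Notation leb := (lebesgue_rV R n).
Notation st := (lebesgue_spacetime R n).
Notation ST := (measurableTypeR R * E)%type.
Notation slaby := (slab +oo%E : set ST).

Variables (m mu nu beta p M : R) (w0 w1 : E -> R) (w v : R -> E -> R) (rhoL : R -> R).
Hypothesis p0 : p != 0.
Hypothesis mrho : measurable_fun setT rhoL.
Hypothesis mw : measurable_fun slaby (fun z => w z.1 z.2).
Hypothesis mv : measurable_fun slaby (fun z => v z.1 z.2).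
Hypothesis sw : forall t, 1 < t -> {ae leb, forall x, ~ cube (rhoL t) x -> w t x = 0}.
Hypothesis sv : forall t, 1 < t -> {ae leb, forall x, ~ cube (rhoL t) x -> v t x = 0}.
Hypothesis w0L : w0 \in Lfun leb 1.
Hypothesis w1L : w1 \in Lfun leb 1.
Hypothesis w0s : {ae leb, forall x, ~ eball M x -> w0 x = 0}.
Hypothesis w1s : {ae leb, forall x, ~ eball M x -> w1 x = 0}.
Hypothesis weak : weak_solution m mu nu +oo%E w0 w1 w (fun t x => `|v t x| `^ p).
Hypothesis cw : C_L2 (time_interval +oo%E) w.
Hypothesis root : beta ^+ 2 - (mu + 1) * beta + mu + nu ^+ 2 = 0.

Variables (A b q : R) (l : nat).
Hypothesis A0 : 0 <= A.
Hypothesis M0 : 0 <= M.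
Hypothesis m1 : 0 < m + 1.
Hypothesis rhoA : forall t, 1 <= t -> rhoL t <= A * t `^ (m + 1).
Hypothesis q1 : 1 < q.
Hypothesis lq : l.+2%:R / q <= l%:R.

Local Notation W := (trunc rhoL w).
Local Notation V := (trunc rhoL v).

Definition weighted (U : ST -> R) (s gam r : R) : \bar R :=
  (\int[st]_(z in slaby) (`|U z| `^ s * zeta gam r l z.1)%:E)%E.

Definition weighted_tail (U : ST -> R) (s gam r : R) : \bar R :=
  (\int[st]_(z in slaby) (`|U z| `^ s * zeta gam r l z.1 * (r <= z.1)%R%:R)%:E)%E.

(** Half-side of a cube that contains all cross-sections of the cone up to time [2 * r]. *)
Let radius r := A * (2 * r) `^ (m + 1).

Let radius_ge0 r : 0 <= radius r.
Proof. by rewrite mulr_ge0 ?powR_ge0. Qed.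

Let rhoL_radius r t : 1 <= t -> t <= 2 * r -> rhoL t <= radius r.
Proof.
move=> t1 tr; apply: le_trans (rhoA t1) _; rewrite ler_wpM2l//.
by apply: ge0_ler_powR => //; [exact: ltW|rewrite nnegrE; lra|rewrite nnegrE; lra].
Qed.

Let identity r : 1 < r ->
  (\int[st]_(z in slaby) (W z * timeop beta r l mu nu z.1)%:E
   = \int[leb]_x ((mu - beta) * w0 x + w1 x)%:E + weighted V p beta r)%E.
Proof.
(* The half-side [radius r + M + 1] of the cutoff is at least [M], to cover the data, and strictly
   larger than that of the cone. *)
move=> r1; have rM : M <= radius r + M + 1 by have := radius_ge0 r; lra.
apply: (weak_identity beta p0 mrho mw mv sw sv w0L w1L w0s w1s weak l r1 rM).
by move=> t t1 tr; apply: le_lt_trans (rhoL_radius t1 tr) _; rewrite -addrA ltrDl ltr_wpDl.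
Qed.

Let measurable_WK r : 1 < r ->
  measurable_fun slaby (fun z => W z * timeop beta r l mu nu z.1).
Proof.
move=> r1; apply: (@measurable_trunc_timeop _ _ m mu nu beta w rhoL mrho mw r (radius r +
  M + 1) l r1).
by move=> t t1 tr; apply: le_lt_trans (rhoL_radius t1 tr) _; rewrite -addrA ltrDl ltr_wpDl.
Qed.

Let shell_le r z : slaby z -> W z != 0 -> (r <= z.1 <= 2 * r)%R -> shell r (radius r) z.
Proof.
move=> zs /trunc_neq0 [z1 zc] zr; split=> // j; apply: le_trans (zc j) _.
by apply: rhoL_radius; [exact: ltW|case/andP: zr].
Qed.

(** The point is that [C0] is independent of [r]. The indicator of the shell combines the time
    localization of [timeop] with the spatial one of [W]. *)
Lemma pointwise_bound : exists2 C0 : R, 0 <= C0 & forall r z, 1 < r -> slaby z ->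
  `|W z * timeop beta r l mu nu z.1| <=
  C0 / r ^+ 2 * (z.1 `^ beta * cutoff r z.1 ^+ l) * (`|W z| * \1_(shell r (radius r)) z).
Proof.
have [B B0 HB] := @step_derivatives_bounded R.
exists (l.+2%:R * (l.+1%:R * B ^+ 2 + B + `|2 * beta - mu| * B)).
  by rewrite mulr_ge0// addr_ge0 ?mulr_ge0// addr_ge0// mulr_ge0// exprn_ge0.
move=> r z r1 zs; have z1 := slab_ge1 zs.
have [->|Wz] := eqVneq (W z) 0; first by rewrite mul0r normr0 mul0r mulr0.
rewrite normrM [leRHS]mulrCA; apply: ler_wpM2l => //.
apply: le_trans (timeop_bound l r1 B0 HB root z1) _.
have [zr|_] := boolP (r <= z.1 <= 2 * r); last first.
  rewrite mulr0 mulr_ge0 ?indicE//; apply: mulr_ge0.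
    rewrite divr_ge0// ?exprn_ge0//; last lra.
    by rewrite mulr_ge0// addr_ge0 ?mulr_ge0// addr_ge0// mulr_ge0// exprn_ge0.
  by rewrite mulr_ge0 ?powR_ge0// exprn_ge0// cutoff_ge0.
by rewrite indicE mem_set ?mulr1//; exact: shell_le.
Qed.


Let mW : measurable_fun setT W. Proof. exact: measurable_trunc. Qed.

Let mWshell r : measurable_fun setT (fun z => `|W z| * \1_(shell r (radius r)) z).
Proof.
apply: measurable_funM; first exact: measurableT_comp.
by apply: measurable_indic; exact: measurable_shell.
Qed.

(** On the shell, which has finite measure, [|W| <= W^2 + 1]; the square is integrable up to time
    [2 * r] by [trunc_L2]. *)
Lemma trunc_shell_lty r : 0 <= r ->
  (\int[st]_(z in slaby) (`|W z| * \1_(shell r (radius r)) z)%:E < +oo)%E.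
Proof.
move=> r0.
have mS := @measurable_slab R n.
pose g z : R := W z ^+ 2 * (z.1 <= 2 * r)%R%:R.
have g0 z : 0 <= g z by rewrite mulr_ge0// sqr_ge0.
have mg : measurable_fun setT g.
  apply: measurable_funM; first exact: measurable_funX.
  rewrite (_ : (fun x => _) = \1_[set z : measurableTypeR R * E | (z.1 : R) <= 2 * r]).
    by apply: measurable_indic; apply: measurable_ler;
      [exact: (@measurable_comp_fst _ _ id)|exact: measurable_cst].
  by apply/funext => z; rewrite indicE; congr (_%:R); congr nat_of_bool; apply/idP/idP;
    rewrite inE.
apply: (@le_lt_trans _ _ (\int[st]_z ((g z)%:E + (\1_(shell r (radius r)) z)%:E))%E).
  apply: (@le_trans _ _ (\int[st]_z (`|W z| * \1_(shell r (radius r)) z)%:E)%E).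
    by apply: ge0_subset_integral => //; exact/measurable_EFinP.
  apply: ge0_le_integral => //.
  - exact/measurable_EFinP.
  - by apply: emeasurable_funD; apply/measurable_EFinP => //; apply: measurable_indic;
    exact: measurable_shell.
  move=> z _; rewrite -EFinD lee_fin /g.
  have [zsh|nz] := pselect (shell r (radius r) z); last first.
    by rewrite indicE memNset// mulr0 addr0; exact: (g0 z).
  rewrite indicE mem_set//.
  have [/andP[_ ->] _] := zsh; rewrite !mulr1 -[W z ^+ 2]real_normK ?num_real//.
  have -> : true%:R = 1 :> R by [].
  by have := sqr_ge0 (`|W z| - 1 / 2); nra.
have mgE : measurable_fun setT (fun z => (g z)%:E) by exact/measurable_EFinP.
have mIE : measurable_fun setT (fun z : ST => (\1_(shell r (radius r)) z : R)%:E).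
  by apply/measurable_EFinP; apply: measurable_indic; exact: measurable_shell.
rewrite ge0_integralD//; last by move=> z _; rewrite lee_fin.
apply: lte_add_pinfty; first exact: (trunc_L2 mrho mw (2 * r) cw).
rewrite integral_indic//; last exact: measurable_shell.
rewrite setIT; apply: le_lt_trans (shell_measure r0 (radius_ge0 r)) _.
by rewrite ltry.
Qed.

Let dataI : \bar R := (\int[leb]_x ((mu - beta) * w0 x + w1 x)%:E)%E.

Lemma data_fin : dataI \is a fin_num.
Proof.
apply: integrable_fin_num => //.
rewrite (_ : (fun x => _) = (fun x => (mu - beta)%:E * (w0 x)%:E + (w1 x)%:E)%E);
  last first.
  by apply/funext => x.
apply: integrableD => //; last exact/Lfun1_integrable.
by apply: integrableZl => //; exact/Lfun1_integrable.
Qed.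

Lemma integral_timeop_le r : 1 < r -> forall h : ST -> R, measurable_fun setT h ->
  (forall z, slaby z -> `|W z * timeop beta r l mu nu z.1| <= h z) ->
  (`| \int[st]_(z in slaby) (W z * timeop beta r l mu nu z.1)%:E | <=
    \int[st]_(z in slaby) (h z)%:E)%E.
Proof.
move=> r1 h mh Hh; have mS := @measurable_slab R n.
have mWK : measurable_fun slaby (fun z => (W z * timeop beta r l mu nu z.1)%:E).
  by apply/measurable_EFinP; exact: measurable_WK.
apply: le_trans (le_abse_integral _ mS mWK) _.
apply: ge0_le_integral => //.
- exact: measurableT_comp.
- by apply/measurable_EFinP; exact: measurable_funTS.
Qed.

(** In the weak identity the integral of [W] against [timeop] is finite, since [W] is integrable on
    the shell, and so is the data term; the nonlinear term is therefore finite too. *)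
Lemma weighted_lty r : 1 < r -> (weighted V p beta r < +oo)%E.
Proof.
move=> r1; have r0 : 0 < r by lra.
have mS := @measurable_slab R n.
have [C0 C00 HC] := pointwise_bound.
pose D := C0 / r ^+ 2 * (2 `^ `|beta| * r `^ beta).
have D0 : 0 <= D.
  by rewrite !mulr_ge0 ?powR_ge0// invr_ge0 exprn_ge0// ltW.
have H : (`| \int[st]_(z in slaby) (W z * timeop beta r l mu nu z.1)%:E | < +oo)%E.
  apply: (@le_lt_trans _ _ (\int[st]_(z in slaby)
      (D * (`|W z| * \1_(shell r (radius r)) z))%:E)%E).
    apply: integral_timeop_le => //; first exact: measurable_funM.
    move=> z zs; apply: le_trans (HC r z r1 zs) _.
    have [/= zsh|nz] := pselect (shell r (radius r) z); last first.
      by rewrite indicE memNset// !mulr0.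
    apply: ler_wpM2r; first by rewrite mulr_ge0.
    apply: ler_wpM2l; first by rewrite divr_ge0// exprn_ge0// ltW.
    apply: le_trans (powR_dyadic_le beta r0 zsh.1); rewrite ler_piMr ?powR_ge0//.
    by rewrite exprn_ile1 ?cutoff_ge0 ?cutoff_le1.
  under eq_integral do rewrite EFinM.
  rewrite ge0_integralZl_EFin//.
  - by rewrite lte_mul_pinfty// trunc_shell_lty// ltW.
  - by apply/measurable_EFinP; apply: measurable_funTS.
move: H; rewrite (identity r1) -/dataI; have := data_fin.
case: dataI => [d| |] // _; case: (weighted V p beta r) => [x| |] // _; first exact: ltry.
Qed.


(** Hoelder's inequality with exponents [q] and [(1 - q^-1)^-1]; the second factor is the constant
    [G] on the shell, so its norm is a power of the shell's measure. *)
Lemma holder_shell r (G : R) (f : ST -> R) : 0 < r -> 0 <= G -> measurable_fun setT f ->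
  (\int[st]_z (`|f z| * (G * \1_(shell r (radius r)) z))%:E <=
   (\int[st]_z (`|f z| `^ q)%:E) `^ q^-1 *
   (G * (r * (2 * radius r) ^+ n) `^ (1 - q^-1))%:E)%E.
Proof.
move=> r0 G0 mf; have q0 : 0 < q := lt_trans ltr01 q1.
have mI : measurable_fun setT (fun z : ST => \1_(shell r (radius r)) z : R).
  by apply: measurable_indic; exact: measurable_shell.
have qc0 : 0 < 1 - q^-1 by rewrite subr_gt0 invf_lt1.
pose g (z : ST) : R := G * \1_(shell r (radius r)) z.
have mg : measurable_fun setT g by apply: measurable_funM.
have qq : q^-1 + (1 - q^-1)^-1^-1 = 1 by rewrite invrK addrC subrK.
have qc1 : 0 < (1 - q^-1)^-1 by rewrite invr_gt0.
have := hoelder st mf mg q0 qc1 qq.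
rewrite Lnorm1 => H.
apply: (@le_trans _ _ (\int[st]_z `|(EFin \o (f \* g)%R) z|)%E).
  apply: ge0_le_integral => //.
  - by move=> z _; rewrite lee_fin mulr_ge0// mulr_ge0.
  - by apply/measurable_EFinP; apply: measurable_funM => //; exact: measurableT_comp.
  - by apply: measurableT_comp => //; apply/measurable_EFinP; exact: measurable_funM.
  - by move=> z _; rewrite /= lee_fin normrM [`|g z|]ger0_norm// mulr_ge0.
apply: le_trans H _; apply: lee_pmul; rewrite ?Lnorm_ge0//.
  by rewrite unlock /=.
rewrite unlock invrK.
have -> : (\int[st]_x (`|(EFin \o g) x| `^ (1 - q^-1)^-1))%E =
    ((G `^ (1 - q^-1)^-1)%:E * st (shell r (radius r)))%E.
  transitivity (\int[st]_x ((G `^ (1 - q^-1)^-1)%:E * (\1_(shell r (radius r)) x)%:E))%E.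
    apply: eq_integral => z _; rewrite /= /g -EFinM; congr _%:E.
    rewrite ger0_norm ?mulr_ge0// powRM//; congr (_ * _).
    by rewrite indicE; case: (_ \in _); rewrite ?powR1// powR0// gt_eqF.
  rewrite ge0_integralZl_EFin ?powR_ge0//; last exact/measurable_EFinP.
  by rewrite integral_indic ?setIT//; exact: measurable_shell.
rewrite poweRM ?lee_fin ?powR_ge0//.
rewrite poweR_EFin -powRrM mulVf ?gt_eqF// powRr1// EFinM.
apply: lee_wpmul2l; first by rewrite lee_fin.
rewrite -poweR_EFin; apply: gt0_ler_poweR.
- exact: ltW.
- by rewrite in_itv/= measure_ge0 leey.
- by rewrite in_itv/= leey andbT lee_fin mulr_ge0 ?(ltW r0)// exprn_ge0// mulr_ge0.
- by apply: shell_measure => //; exact: ltW.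
Qed.

(** The exponent of [r] has three sources: [-2] from the two time derivatives, [beta - b / q] from
    exchanging the weight [t^beta] for the [q]-th root of [t^b], and the measure of the shell, of
    duration [r] and width of order [r^(m+1)] in each direction, raised to [1 - 1/q]. *)
Lemma key_estimate : exists2 C : R, 0 <= C & forall r, 1 < r ->
  (dataI + weighted V p beta r <=
   (C * r `^ (- 2 + (beta - b / q) + (1 + n%:R * (m + 1)) * (1 - q^-1)))%:E *
   (weighted_tail W q b r) `^ q^-1)%E.
Proof.
have [C0 C00 HC] := pointwise_bound.
pose s := beta - b / q; have q0 : 0 < q := lt_trans ltr01 q1.
pose k := (2 * A * 2 `^ (m + 1)) ^+ n.
have k0 : 0 <= k by rewrite exprn_ge0// !mulr_ge0 ?powR_ge0.
exists (C0 * 2 `^ `|s| * k `^ (1 - q^-1)); first by rewrite !mulr_ge0 ?powR_ge0.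
move=> r r1; have r0 : 0 < r by lra.
have mS := @measurable_slab R n.
(* [G] bounds what remains of the operator after the [q]-th root of [zeta b r l] is extracted; that
   root goes into [f], whose [q]-th power is dominated by the integrand of [weighted_tail]. *)
pose G := C0 / r ^+ 2 * (2 `^ `|s| * r `^ s).
have G0 : 0 <= G by rewrite !mulr_ge0 ?powR_ge0// invr_ge0 exprn_ge0// ltW.
pose f z := W z * (zeta b r l z.1) `^ q^-1 * \1_(shell r (radius r)) z.
have mI : measurable_fun setT (fun z : ST => \1_(shell r (radius r)) z : R).
  by apply: measurable_indic; exact: measurable_shell.
have mz gam : measurable_fun setT (fun z : ST => zeta gam r l z.1).
  apply: (@measurable_comp_fst R n (zeta gam r l)).
  exact: Ck_measurable (Ck_zeta gam r l 0).
have mf : measurable_fun setT f.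
  apply: measurable_funM => //; apply: measurable_funM => //.
  by apply: (measurableT_comp (measurable_powR _)).
have zs z : shell r (radius r) z -> slaby z.
  by move=> [/andP[z1 _] _]; split=> //; split; [lra|rewrite ltry].
have := holder_shell r0 G0 mf => H.
rewrite -(identity r1); apply: le_trans (lee_abs _) _.
apply: (@le_trans _ _ (\int[st]_(z in slaby) (`|f z| * (G * \1_(shell r (radius r))
  z))%:E)%E).
  apply: integral_timeop_le => //.
    by apply: measurable_funM; [exact: measurableT_comp|exact: measurable_funM].
  move=> z zs1; apply: le_trans (HC r z r1 zs1) _.
  have [zsh|nz] := pselect (shell r (radius r) z); last by rewrite indicE memNset// !mulr0.
  have [zr _] := zsh.
  have z1 : (1 : R) <= z.1 := slab_ge1 zs1.
  have z0 : (0 : R) < z.1 by lra.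
  have K : z.1 `^ beta * cutoff r z.1 ^+ l <=
      zeta b r l z.1 `^ q^-1 * (2 `^ `|s| * r `^ s).
    rewrite zetaE; last by apply: le_trans z1; lra.
    rewrite powRM ?powR_ge0// ?exprn_ge0 ?cutoff_ge0// -powRrM.
    have -> : z.1 `^ beta = z.1 `^ (b / q) * z.1 `^ s.
      rewrite -powRD; first by congr (_ `^ _); rewrite /s addrC subrK.
      by apply/implyP => _; rewrite gt_eqF.
    rewrite -!mulrA; apply: ler_wpM2l; first exact: powR_ge0.
    rewrite [leRHS]mulrC; apply: ler_pM; rewrite ?powR_ge0 ?exprn_ge0 ?cutoff_ge0//.
      exact: powR_dyadic_le.
    by apply: expr_le_powR => //; rewrite cutoff_ge0 cutoff_le1.
  rewrite /f indicE mem_set// !mulr1 normrM (ger0_norm (powR_ge0 _ _)).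
  rewrite (_ : `|W z| * _ * G = C0 / r ^+ 2 *
     (zeta b r l z.1 `^ q^-1 * (2 `^ `|s| * r `^ s)) * `|W z|); last by rewrite /G; ring.
  apply: ler_wpM2r => //; apply: ler_wpM2l => //.
  by rewrite divr_ge0// exprn_ge0// ltW.
apply: (@le_trans _ _ (\int[st]_z (`|f z| * (G * \1_(shell r (radius r)) z))%:E)%E).
  apply: ge0_subset_integral => //.
  - apply/measurable_EFinP; apply: measurable_funM;
    [exact: measurableT_comp|exact: measurable_funM].
  - by move=> z _; rewrite lee_fin mulr_ge0// mulr_ge0.
apply: le_trans H _; rewrite muleC; apply: lee_pmul.
- rewrite lee_fin mulr_ge0 ?powR_ge0//.
- exact: poweR_ge0.
- rewrite lee_fin le_eqVlt; apply/orP; left; apply/eqP.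
  rewrite /G /radius.
  have -> : (2 * (A * (2 * r) `^ (m + 1))) ^+ n = k * r `^ (n%:R * (m + 1)).
    rewrite [n%:R * _]mulrC powRrM powR_mulrn ?powR_ge0// -exprMn; congr (_ ^+ n).
    by rewrite powRM ?(ltW r0)//; ring.
  have rn : (r != 0) by rewrite gt_eqF.
  have -> : r * (k * r `^ (n%:R * (m + 1))) = k * r `^ (1 + n%:R * (m + 1)).
    rewrite powRD; last by rewrite rn implybT.
    by rewrite powRr1 ?(ltW r0)//; ring.
  have Pr x y : r `^ (x + y) = r `^ x * r `^ y by apply: powRD; rewrite rn implybT.
  rewrite powRM ?powR_ge0// -powRrM -/s (Pr (- 2 + s)) (Pr (- 2)) (powRN r 2)
    powR_mulrn ?(ltW r0)//.
  by field.
- apply: gt0_ler_poweR.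
  + by rewrite invr_ge0 ltW.
  + by rewrite in_itv/= leey andbT; apply: integral_ge0 => z _; rewrite lee_fin powR_ge0.
  + rewrite in_itv/= leey andbT; apply: integral_ge0 => z _; rewrite lee_fin.
    by rewrite mulr_ge0// mulr_ge0 ?powR_ge0 ?zeta_ge0.
  rewrite /weighted_tail [leRHS]integral_mkcond; apply: ge0_le_integral => //.
  - by apply/measurable_EFinP; exact: measurable_norm_powR.
  - have [+ _] := measurable_restrictT (fun z : ST =>
    (`|W z| `^ q * zeta b r l z.1 * (r <= z.1)%R%:R)%:E) mS.
    apply; apply/measurable_EFinP; apply: measurable_funTS.
    apply: measurable_funM; first by apply: measurable_funM => //;
      exact: measurable_norm_powR.
    rewrite (_ : (fun x => _) = \1_[set z : ST | r <= (z.1 : R)]).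
      by apply: measurable_indic; apply: measurable_ler;
        [exact: measurable_cst|exact: (@measurable_comp_fst _ _ id)].
    by apply/funext => z; rewrite indicE; congr (_%:R); congr nat_of_bool; apply/idP/idP;
      rewrite inE.
  move=> z _; rewrite patchE; case: ifPn => [|]; last first.
    rewrite notin_setE => nz.
    have nsh : ~ shell r (radius r) z by move/zs.
    by rewrite /f indicE memNset// mulr0 normr0 powR0// gt_eqF.
  move=> _; rewrite lee_fin /f.
  have [zsh|nz] := pselect (shell r (radius r) z); last first.
    rewrite indicE memNset// mulr0 normr0 powR0 ?gt_eqF//.
    by rewrite mulr_ge0// mulr_ge0 ?powR_ge0 ?zeta_ge0.
  have [/andP[-> _] _] := zsh.
  rewrite indicE mem_set// !mulr1 normrM powRM// [`|_ `^ _|]ger0_norm ?powR_ge0//.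
  by rewrite -[(zeta _ _ _ _ `^ _) `^ _]powRrM mulVf ?gt_eqF// powRr1 ?zeta_ge0.
Qed.

End key_estimate.

(** * The growth argument and the arithmetic of exponents *)

Section growth.
Context {R : realType}.

(** The cutoffs inside [X] and [Xt] change with [r], so tails at different scales do not add up
    directly. [F] stands for the integral up to time [r] without cutoff; it is additive over scales
    and still below [X]. *)
Lemma growth_contradiction (X Xt F : R -> R) (i K theta : R) :
  0 < i -> 0 <= K -> 0 < theta < 1 ->
  (forall r, 1 < r -> i + X r <= K * Xt r `^ theta /\ [/\ 0 <= Xt r, Xt r <= X r,
     0 <= F r, F r <= X r & Xt r + F r <= F (2 * r)]) -> False.
Proof.
move=> i0 K0 /andP[t0 t1] H.
have Kgt0 : 0 < K.
  have h2 : 1 < 2 :> R by lra.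
  have [H1 [Xt0 XtX _ _ _]] := H _ h2.
  rewrite lt_neqAle K0 andbT; apply/eqP => K00; rewrite -K00 mul0r in H1.
  by lra.
(* Solves [X = K * X^theta], the extreme case allowed by [Xt <= X]. *)
pose B := K `^ (1 - theta)^-1.
have XB r : 1 < r -> X r <= B.
  move=> r1; have [H1 [Xt0 XtX _ _ _]] := H r r1.
  have X0 : 0 <= X r by apply: le_trans XtX.
  have [->|Xn0] := eqVneq (X r) 0; first exact: powR_ge0.
  have Xgt0 : 0 < X r by rewrite lt_neqAle eq_sym Xn0.
  have : X r `^ (1 - theta) <= K.
    rewrite powRB; last by apply/implyP.
    rewrite powRr1// ler_pdivrMr ?powR_gt0//.
    apply: (@le_trans _ _ (K * Xt r `^ theta)); first by lra.
    by rewrite ler_wpM2l// ge0_ler_powR ?nnegrE// ltW.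
  have e0 : 0 < (1 - theta)^-1 by rewrite invr_gt0 subr_gt0.
  move=> H2; have := ge0_ler_powR (ltW e0) _ _ H2.
  rewrite !nnegrE powR_ge0 => /(_ isT (ltW Kgt0)).
  by rewrite -powRrM divff ?powRr1// subr_eq0 eq_sym lt_eqF.
(* Solves [i = K * c^theta]: the least tail compatible with [i <= K * Xt^theta]. *)
pose c := (i / K) `^ theta^-1.
have c0 : 0 < c by rewrite powR_gt0// divr_gt0.
have Xtc r : 1 < r -> c <= Xt r.
  move=> r1; have [H1 [Xt0 XtX _ _ _]] := H r r1.
  have : i / K <= Xt r `^ theta by rewrite ler_pdivrMr// mulrC; lra.
  have e0 : 0 < theta^-1 by rewrite invr_gt0.
  move=> H2; have := ge0_ler_powR (ltW e0) _ _ H2.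
  rewrite !nnegrE powR_ge0 divr_ge0 ?(ltW i0)// => /(_ isT isT).
  by rewrite -powRrM divff ?gt_eqF// powRr1.
(* The scales start at [2], as the estimates hold only for [r > 1]. *)
have FN (N : nat) : N%:R * c <= F (2 ^+ N.+1).
  have p2 k : 1 < 2 ^+ k.+1 :> R by rewrite exprn_egt1// ltr1n.
  elim: N => [|N IH].
    by rewrite mul0r; have [_ [_ _ + _ _]] := H _ (p2 0).
  have [_ [_ _ _ _ H6]] := H _ (p2 N); rewrite [2 ^+ N.+2]exprS.
  apply: le_trans H6; rewrite -natr1 mulrDl mul1r addrC; apply: lerD => //.
  exact: Xtc.
have := archi_boundP (_ : 0 <= B / c); set N := Num.bound _.
rewrite divr_ge0 ?powR_ge0 ?(ltW c0)// => /(_ isT).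
rewrite ltr_pdivrMr// ltNge => /negP; apply.
apply: le_trans (FN N) _; have h : 1 < 2 ^+ N.+1 :> R by rewrite exprn_egt1// ltr1n.
by have [_ [_ _ _ + _]] := H _ h; move=> /le_trans; apply; exact: XB.
Qed.

(** [delta_ mu nu] is the discriminant [(mu + 1)^2 - 4 (mu + nu^2)] of this quadratic. *)
Lemma beta_root (mu nu : R) : 0 < delta_ mu nu ->
  beta_ mu nu ^+ 2 - (mu + 1) * beta_ mu nu + mu + nu ^+ 2 = 0.
Proof.
move=> d0; rewrite /beta_.
have := sqr_sqrtr (ltW d0); set s := Num.sqrt _; rewrite /delta_ => hs.
rewrite (_ : nu ^+ 2 = ((mu - 1) ^+ 2 - s ^+ 2) / 4); last by rewrite hs; field.
by field.
Qed.

(** In the combined exponent [b2] cancels, and the sum is exactly [-2 (pq - 1) / (pq)] times the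
    quantity assumed nonnegative; equality, the critical case, is allowed. *)
Lemma exponent_le0 (p q b1 b2 N : R) : 1 < p -> 1 < q ->
  0 <= (p + 1) / (p * q - 1) - (b1 - 1) / 2 - N / 2 ->
  (- 2 + (b1 - b2 / q) + (1 + N) * (1 - q^-1))
  + (- 2 + (b2 - b1 / p) + (1 + N) * (1 - p^-1)) / q <= 0.
Proof.
move=> p1 q1 H.
have pq1 : 1 < p * q by rewrite mulr_egt1.
have pn : p != 0 by rewrite gt_eqF// (lt_trans ltr01).
have qn : q != 0 by rewrite gt_eqF// (lt_trans ltr01).
rewrite (_ : _ + _ = - (2 * ((p * q - 1) / (p * q)) *
   ((p + 1) / (p * q - 1) - (b1 - 1) / 2 - N / 2))); last first.
  by field; rewrite pn qn /= subr_eq0 gt_eqF.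
rewrite oppr_le0 mulr_ge0// mulr_ge0// divr_ge0//.
  by rewrite subr_ge0 ltW.
by rewrite (le_trans ler01)// ltW.
Qed.

End growth.

(** * Comparison of weighted integrals at successive scales *)

Section dyadic.
Context {R : realType} {n : nat}.
Notation E := 'rV[R]_n.
Notation st := (lebesgue_spacetime R n).
Notation ST := (measurableTypeR R * E)%type.
Notation slaby := (slab +oo%E : set ST).

Variables (U : ST -> R) (s gam : R) (l : nat).
Hypothesis mU : measurable_fun setT U.

Definition weighted_below (r : R) : \bar R :=
  (\int[st]_(z in slaby) (`|U z| `^ s * z.1 `^ gam * (z.1 < r)%R%:R)%:E)%E.

Let mS : measurable slaby. Proof. exact: measurable_slab. Qed.

Let mzeta r : measurable_fun slaby (fun z => `|U z| `^ s * zeta gam r l z.1).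
Proof.
apply: measurable_funTS; apply: measurable_funM; first exact: measurable_norm_powR.
apply: (@measurable_comp_fst R n (zeta gam r l)).
exact: Ck_measurable (Ck_zeta gam r l 0).
Qed.

Let mbelow r : measurable_fun slaby (fun z => `|U z| `^ s * z.1 `^ gam * (z.1 < r)%R%:R).
Proof.
apply: measurable_funTS; apply: measurable_funM.
  apply: measurable_funM; first exact: measurable_norm_powR.
  by apply: (@measurable_comp_fst R n (fun t => t `^ gam)); exact: measurable_powR.
rewrite (_ : (fun x => _) = \1_[set z : ST | (z.1 : R) < r]).
  by apply: measurable_indic; apply: measurable_ltr;
    [exact: (@measurable_comp_fst _ _ id)|exact: measurable_cst].
by apply/funext => z; rewrite indicE; congr (_%:R); congr nat_of_bool; apply/idP/idP;
  rewrite inE.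
Qed.

Let mtail r : measurable_fun slaby (fun z =>
  `|U z| `^ s * zeta gam r l z.1 * (r <= z.1)%R%:R).
Proof.
apply: measurable_funM; first exact: mzeta.
apply: measurable_funTS; rewrite (_ : (fun x => _) = \1_[set z : ST | r <= (z.1 : R)]).
  by apply: measurable_indic; apply: measurable_ler;
    [exact: measurable_cst|exact: (@measurable_comp_fst _ _ id)].
by apply/funext => z; rewrite indicE; congr (_%:R); congr nat_of_bool; apply/idP/idP;
  rewrite inE.
Qed.

Lemma weighted_ge0 r : (0 <= weighted l U s gam r)%E.
Proof. by apply: integral_ge0 => z _; rewrite lee_fin mulr_ge0 ?powR_ge0 ?zeta_ge0. Qed.

Lemma weighted_tail_ge0 r : (0 <= weighted_tail l U s gam r)%E.
Proof.
by apply: integral_ge0 => z _; rewrite lee_fin mulr_ge0// mulr_ge0 ?powR_ge0 ?zeta_ge0.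
Qed.

Lemma weighted_below_ge0 r : (0 <= weighted_below r)%E.
Proof. by apply: integral_ge0 => z _; rewrite lee_fin mulr_ge0// mulr_ge0 ?powR_ge0. Qed.

Lemma weighted_tail_le r : (weighted_tail l U s gam r <= weighted l U s gam r)%E.
Proof.
apply: ge0_le_integral => //.
- by move=> z _; rewrite lee_fin mulr_ge0// mulr_ge0 ?powR_ge0 ?zeta_ge0.
- exact/measurable_EFinP.
- exact/measurable_EFinP.
- move=> z _; rewrite lee_fin ler_piMr//; first by rewrite mulr_ge0 ?powR_ge0 ?zeta_ge0.
  by case: (r <= z.1)%R; rewrite ?ler01.
Qed.

Lemma weighted_below_le r : 1 < r -> (weighted_below r <= weighted l U s gam r)%E.
Proof.
move=> r1; apply: ge0_le_integral => //.
- by move=> z _; rewrite lee_fin mulr_ge0// mulr_ge0 ?powR_ge0.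
- exact/measurable_EFinP.
- exact/measurable_EFinP.
- move=> z zs; rewrite lee_fin; have z1 := slab_ge1 zs.
  case: ltP => [zr|_]; last by rewrite mulr0 mulr_ge0 ?powR_ge0 ?zeta_ge0.
  rewrite mulr1 zetaE; last by apply: le_trans z1; lra.
  by rewrite cutoff_eq1 ?(ltW zr)// expr1n mulr1.
Qed.

(** The tail is carried by [r <= t < 2 * r], where the cutoff is at most [1]; at [t = 2 * r],
    excluded from [weighted_below (2 * r)], the cutoff is already [0]. *)
Lemma weighted_tail_below r : 1 < r ->
  (weighted_tail l U s gam r + weighted_below r <= weighted_below (2 * r))%E.
Proof.
have t0 r' z : slaby z -> (0 <= (`|U z| `^ s * zeta gam r' l z.1 * (r' <= z.1)%R%:R)%:E)%E.
  by move=> _; rewrite lee_fin mulr_ge0// mulr_ge0 ?powR_ge0 ?zeta_ge0.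
have b0 r' z : slaby z -> (0 <= (`|U z| `^ s * z.1 `^ gam * (z.1 < r')%R%:R)%:E)%E.
  by move=> _; rewrite lee_fin mulr_ge0// mulr_ge0 ?powR_ge0.
have mt r' : measurable_fun slaby (fun z =>
  (`|U z| `^ s * zeta gam r' l z.1 * (r' <= z.1)%R%:R)%:E).
  exact/measurable_EFinP.
have mb r' : measurable_fun slaby (fun z =>
  (`|U z| `^ s * z.1 `^ gam * (z.1 < r')%R%:R)%:E).
  exact/measurable_EFinP.
move=> r1; rewrite /weighted_tail /weighted_below -(ge0_integralD _ mS (t0 r) (mt r)
  (b0 r) (mb r)).
apply: ge0_le_integral => //.
- by move=> z zs; rewrite adde_ge0// ?t0// b0.
- exact: emeasurable_funD.
- move=> z zs; rewrite -EFinD lee_fin; have z1 := slab_ge1 zs.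
  rewrite zetaE; last by apply: le_trans z1; lra.
  have c0 : 0 <= cutoff r z.1 ^+ l.+2 by rewrite exprn_ge0// cutoff_ge0.
  have c1 : cutoff r z.1 ^+ l.+2 <= 1 by rewrite exprn_ile1 ?cutoff_ge0 ?cutoff_le1.
  have c2 : 2 * r <= z.1 -> cutoff r z.1 ^+ l.+2 = 0.
    by move=> zr; rewrite cutoff_eq0 ?expr0n//; lra.
  set c := (cutoff _ _ ^+ _) in c0 c1 c2 *.
  set x := (_ `^ s); set y := (_ `^ gam).
  rewrite (_ : _ + _ = x * y * (c * (r <= z.1)%R%:R + (z.1 < r)%R%:R)); last by ring.
  apply: ler_wpM2l; first by rewrite mulr_ge0 ?powR_ge0.
  have [zr|zr] := ltP (z.1 : R) r.
    by rewrite mulr0 add0r (lt_trans zr)//; lra.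
  rewrite mulr1 addr0; have [z2|z2] := ltP (z.1 : R) (2 * r); first exact: c1.
  by rewrite (c2 z2).
Qed.

End dyadic.

(** * Blow-up *)

Section blowup.
Context {R : realType} {n : nat}.
Notation E := 'rV[R]_n.
Notation leb := (lebesgue_rV R n).

(** The second inequality, with [j'] dropped and [y <= Y], is inserted into the first; the resulting
    factor [r^(a + a'/q)] is at most [1]. *)
Lemma coupled_estimate (p q C D j X Y x y j' r a a' : R) :
  0 < p -> 0 < q -> 0 <= C -> 0 <= D -> 0 <= j' -> 0 <= x -> 0 <= y -> y <= Y -> 1 < r ->
  a + a' / q <= 0 ->
  j + X <= C * r `^ a * y `^ q^-1 ->
  j' + Y <= D * r `^ a' * x `^ p^-1 ->
  j + X <= C * D `^ q^-1 * x `^ (p^-1 * q^-1).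
Proof.
move=> p0 q0 C0 D0 j0 x0 y0 yY r1 e0 E1 E2.
have r0 : 0 < r := lt_trans ltr01 r1.
apply: le_trans E1 _.
have Y1 : y <= D * r `^ a' * x `^ p^-1.
  by apply: le_trans yY _; apply: le_trans E2; rewrite lerDr.
have Y2 : y `^ q^-1 <= D `^ q^-1 * r `^ (a' / q) * x `^ (p^-1 * q^-1).
  rewrite (powRrM r) (powRrM x) -!powRM ?powR_ge0 ?mulr_ge0 ?powR_ge0//.
  by apply: ge0_ler_powR; rewrite ?nnegrE ?invr_ge0 ?mulr_ge0 ?powR_ge0 ?(ltW q0).
apply: (@le_trans _ _ (C * r `^ a * (D `^ q^-1 * r `^ (a' / q) * x `^ (p^-1 * q^-1)))).
  by rewrite ler_wpM2l// mulr_ge0 ?powR_ge0.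
rewrite (_ : C * r `^ a * _ = C * D `^ q^-1 * x `^ (p^-1 * q^-1) * r `^ (a + a' / q));
  last first.
  by rewrite powRD; [ring|apply/implyP => _; rewrite gt_eqF].
rewrite ler_piMr//; first by rewrite !mulr_ge0 ?powR_ge0.
by rewrite -[leRHS](powRr0 r) ler_powR// ltW.
Qed.

Lemma fine_estimate (d X Y : \bar R) (c theta : R) :
  d \is a fin_num -> X \is a fin_num -> Y \is a fin_num ->
  (d + X <= c%:E * Y `^ theta)%E -> fine d + fine X <= c * fine Y `^ theta.
Proof.
by case: d => [d| |] //; case: X => [X| |] //; case: Y => [Y| |].
Qed.

(** Exchanging the two components swaps the members of the maximum in [Gamma_], so only one of them
    has to be treated. *)
Lemma energy_solution_sym (m mu1 mu2 nu1 nu2 p q M : R) (u0 u1 v0 v1 : E -> R)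
  (T : \bar R) (u v : R -> E -> R) :
  energy_solution m mu1 mu2 nu1 nu2 p q M u0 u1 v0 v1 T u v ->
  energy_solution m mu2 mu1 nu2 nu1 q p M v0 v1 u0 u1 T v u.
Proof. by case=> *; split=> //; move=> t t1 tT; rewrite setUC; auto. Qed.

Lemma measurable_phi (m M : R) : measurable_fun setT (fun t : R => phi_ m t - phi_ m 1 + M).
Proof.
apply: measurable_funD => //; apply: measurable_funB => //.
apply: measurable_funM => //; exact: measurable_powR.
Qed.

(** The nonnegative [phi_ m 1] is dropped and [M] is absorbed, since [t^(m+1) >= 1]. *)
Lemma phi_bound (m M t : R) : 0 < m + 1 -> 0 <= M -> 1 <= t ->
  phi_ m t - phi_ m 1 + M <= ((m + 1)^-1 + M) * t `^ (m + 1).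
Proof.
move=> m1 M0 t1; rewrite /phi_ powR1 mulrDl mul1r [_^-1 * _]mulrC.
have P1 : 1 <= t `^ (m + 1) by rewrite -[leLHS](powRr0 t) ler_powR// ltW.
apply: lerD; first by rewrite lerBlDr lerDl invr_ge0 ltW.
by rewrite ler_peMr.
Qed.

Lemma no_energy_solution (m mu1 mu2 nu1 nu2 M p q : R) (u0 u1 v0 v1 : E -> R)
  (u v : R -> E -> R) :
  -1 < m -> 0 < delta_ mu1 nu1 -> 0 < delta_ mu2 nu2 ->
  data_space u0 u1 -> data_space v0 v1 -> 0 < M ->
  esupp u0 `|` esupp u1 `|` esupp v0 `|` esupp v1 `<=` @eball R n M ->
  (0 < liminf_ball_integral (fun x =>
         ((mu1 - 1 + Num.sqrt (delta_ mu1 nu1)) / 2 * u0 x + u1 x)%R))%E ->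
  (0 < liminf_ball_integral (fun x =>
         ((mu2 - 1 + Num.sqrt (delta_ mu2 nu2)) / 2 * v0 x + v1 x)%R))%E ->
  1 < p -> 1 < q ->
  0 <= (p + 1) / (p * q - 1) - (beta_ mu1 nu1 - 1) / 2 - (m + 1) * n%:R / 2 ->
  energy_solution m mu1 mu2 nu1 nu2 p q M u0 u1 v0 v1 +oo%E u v -> False.
Proof.
move=> m1 d1 d2 [u0L _ u1L _] [v0L _ v1L _] M0 supp I1 I2 p1 q1 G.
case=> mu mv [_ [cu _]] [_ [cv _]] es wu wv.
pose rhoL (t : R) := phi_ m t - phi_ m 1 + M.
have mrho : measurable_fun setT rhoL by exact: measurable_phi.
have m10 : 0 < m + 1 by rewrite -ltrBlDr sub0r.
pose A := (m + 1)^-1 + M.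
have A0 : 0 <= A by rewrite addr_ge0 ?invr_ge0// ltW.
have rhoA t : 1 <= t -> rhoL t <= A * t `^ (m + 1).
  by move=> t1; apply: phi_bound => //; exact: ltW.
have su t : 1 < t -> {ae leb, forall x, ~ cube (rhoL t) x -> u t x = 0}.
  move=> t1; apply: esupp_ae => x xs; apply: eball_cube; apply: (es t t1);
    first by rewrite ltry.
  by left.
have sv t : 1 < t -> {ae leb, forall x, ~ cube (rhoL t) x -> v t x = 0}.
  move=> t1; apply: esupp_ae => x xs; apply: eball_cube; apply: (es t t1);
    first by rewrite ltry.
  by right.
have u0s : {ae leb, forall x, ~ eball M x -> u0 x = 0}.
  by apply: esupp_ae => x xs; apply: supp; left; left; left.
have u1s : {ae leb, forall x, ~ eball M x -> u1 x = 0}.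
  by apply: esupp_ae => x xs; apply: supp; left; left; right.
have v0s : {ae leb, forall x, ~ eball M x -> v0 x = 0}.
  by apply: esupp_ae => x xs; apply: supp; left; right.
have v1s : {ae leb, forall x, ~ eball M x -> v1 x = 0}.
  by apply: esupp_ae => x xs; apply: supp; right.
have p0 : 0 < p := lt_trans ltr01 p1; have q0 : 0 < q := lt_trans ltr01 q1.
have pn0 : p != 0 by rewrite gt_eqF.
have qn0 : q != 0 by rewrite gt_eqF.
(* The two conditions amount to [l >= 2 / (p - 1)] and [l >= 2 / (q - 1)]; a natural number above
   the sum meets both. *)
have [l lp lq] : exists2 l : nat, l.+2%:R / p <= l%:R & l.+2%:R / q <= l%:R.
  pose N := Num.bound (2 / (p - 1) + 2 / (q - 1)).
  have a0 : 0 <= 2 / (p - 1) by rewrite divr_ge0// subr_ge0 ltW.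
  have b0 : 0 <= 2 / (q - 1) by rewrite divr_ge0// subr_ge0 ltW.
  have := archi_boundP (addr_ge0 a0 b0); rewrite -/N => HN.
  exists N; rewrite ler_pdivrMr// -addn2 natrD addrC -lerBrDr -[X in _ - X]mulr1 -mulrBr
    -ler_pdivrMr ?subr_gt0//; apply: ltW; apply: le_lt_trans HN.
    by rewrite lerDl.
  by rewrite lerDr.
set b1 := beta_ mu1 nu1 in G *; pose b2 := beta_ mu2 nu2.
have root1 := beta_root d1; have root2 := beta_root d2.
have M0' := ltW M0.
(* Each equation is estimated by the tail with the weight of the other one: [|u|^q] is the source of
   the second equation, which is tested with [t^b2], and conversely. *)
have [C C0 HC] := key_estimate pn0 mrho mu mv su sv u0L u1L u0s u1s wu root1 b2 A0 M0'
  m10 rhoA q1 lq.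
have [D D0 HD] := key_estimate qn0 mrho mv mu sv su v0L v1L v0s v1s wv root2 b1 A0 M0'
  m10 rhoA p1 lp.
have lX := weighted_lty pn0 mrho mu mv su sv u0L u1L u0s u1s wu cu root1 l A0 M0' m10 rhoA.
have lY := weighted_lty qn0 mrho mv mu sv su v0L v1L v0s v1s wv cv root2 l A0 M0' m10 rhoA.
set U := trunc rhoL u in HC HD lX lY; set V := trunc rhoL v in HC HD lX lY.
have mU : measurable_fun setT U by exact: measurable_trunc.
have mV : measurable_fun setT V by exact: measurable_trunc.
(* Identifies the coefficient produced by the weak identity with the one in the assumption on the
   data. *)
have dataE (a b : R) : a - beta_ a b = (a - 1 + Num.sqrt (delta_ a b)) / 2.
  by rewrite /beta_; field.
have i1 : (0 < \int[leb]_x ((mu1 - b1) * u0 x + u1 x)%:E)%E.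
  rewrite dataE; apply: (liminf_ball_gt0 (M := M)) => //.
    by apply: measurable_funD; [apply: measurable_funM => //|]; exact: Lfun1_measurable.
  by apply: filterS2 u0s u1s => x h0 h1 xM; rewrite h0// h1// mulr0 addr0.
have i2 : (0 < \int[leb]_x ((mu2 - b2) * v0 x + v1 x)%:E)%E.
  rewrite dataE; apply: (liminf_ball_gt0 (M := M)) => //.
    by apply: measurable_funD; [apply: measurable_funM => //|]; exact: Lfun1_measurable.
  by apply: filterS2 v0s v1s => x h0 h1 xM; rewrite h0// h1// mulr0 addr0.
have f1 := data_fin mu1 b1 u0L u1L; have f2 := data_fin mu2 b2 v0L v1L.
set J1 := integral _ _ _ in f1 i1; set J2 := integral _ _ _ in f2 i2.
have j1 : 0 < fine J1 by rewrite fine_gt0// i1 ltey_eq f1.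
have j2 : 0 < fine J2 by rewrite fine_gt0// i2 ltey_eq f2.
have th : 0 < p^-1 * q^-1 < 1.
  rewrite mulr_gt0 ?invr_gt0//= -invfM invf_lt1 ?mulr_gt0//.
  by rewrite mulr_egt1.
have KP : 0 <= C * D `^ q^-1 by rewrite mulr_ge0// powR_ge0.
apply: (@growth_contradiction R (fun r => fine (weighted l V p b1 r))
  (fun r => fine (weighted_tail l V p b1 r)) (fun r => fine (weighted_below V p b1 r))
  (fine J1) (C * D `^ q^-1) (p^-1 * q^-1) j1 KP th) => r r1.
have fX : weighted l V p b1 r \is a fin_num by rewrite ge0_fin_numE ?weighted_ge0 ?lX.
have fY : weighted l U q b2 r \is a fin_num by rewrite ge0_fin_numE ?weighted_ge0 ?lY.
have fXt : weighted_tail l V p b1 r \is a fin_num.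
  by rewrite ge0_fin_numE ?weighted_tail_ge0// (le_lt_trans (weighted_tail_le _ _ _ mV
    _))// lX.
have fYt : weighted_tail l U q b2 r \is a fin_num.
  by rewrite ge0_fin_numE ?weighted_tail_ge0// (le_lt_trans (weighted_tail_le _ _ _ mU
    _))// lY.
have fB s : 1 < s -> weighted_below V p b1 s \is a fin_num.
  move=> s1; rewrite ge0_fin_numE ?weighted_below_ge0//.
  by rewrite (le_lt_trans (weighted_below_le p b1 l mV s1))// lX.
have r2 : 1 < 2 * r by rewrite (lt_trans r1)// ltr_pMl ?ltr1n// (lt_trans ltr01).
have Xt0 : 0 <= fine (weighted_tail l V p b1 r) by rewrite fine_ge0// weighted_tail_ge0.
have Yt0 : 0 <= fine (weighted_tail l U q b2 r) by rewrite fine_ge0// weighted_tail_ge0.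
have XtX := weighted_tail_le p b1 l mV r.
have YtY := fine_le fYt fY (weighted_tail_le q b2 l mU r).
have BX := weighted_below_le p b1 l mV r1.
have BB := weighted_tail_below p b1 l mV r1.
have B0 : (0 <= fine (weighted_below V p b1 r))%R by rewrite fine_ge0// weighted_below_ge0.
have XtX' := fine_le fXt fX XtX.
have BX' := fine_le (fB r r1) fX BX.
have TB : weighted_tail l V p b1 r + weighted_below V p b1 r \is a fin_num.
  by rewrite fin_numD fXt fB.
have BB' := fine_le TB (fB _ r2) BB.
rewrite (fineD fXt (fB r r1)) in BB'.
refine (conj _ (And5 Xt0 XtX' B0 BX' BB')).
have E1 := fine_estimate f1 fX fYt (HC r r1).
have E2 := fine_estimate f2 fY fXt (HD r r1).
have NE : (m + 1) * n%:R = n%:R * (m + 1) := mulrC _ _.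
rewrite NE in G.
have e0 := @exponent_le0 R p q b1 b2 (n%:R * (m + 1)) p1 q1 G.
exact: (coupled_estimate p0 q0 C0 D0 (ltW j2) Xt0 Yt0 YtY r1 e0 E1 E2).
Qed.

End blowup.

Theorem theorem2p1 (R : realType) (n : nat) (m mu1 mu2 nu1 nu2 M p q : R)
  (u0 u1 v0 v1 : 'rV[R]_n -> R) :
  (1 <= n)%N -> -1 < m ->
  (m < 0 -> 1 < mu1 /\ 1 < mu2) ->
  (0 <= m -> 0 < mu1 /\ 0 < mu2) ->
  0 < delta_ mu1 nu1 -> 0 < delta_ mu2 nu2 ->
  data_space u0 u1 -> data_space v0 v1 ->
  0 < M ->
  esupp u0 `|` esupp u1 `|` esupp v0 `|` esupp v1 `<=` @eball R n M ->
  (0 < liminf_ball_integral (fun x =>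
         ((mu1 - 1 + Num.sqrt (delta_ mu1 nu1)) / 2 * u0 x + u1 x)%R))%E ->
  (0 < liminf_ball_integral (fun x =>
         ((mu2 - 1 + Num.sqrt (delta_ mu2 nu2)) / 2 * v0 x + v1 x)%R))%E ->
  1 < p -> 1 < q ->
  (1 + beta_ mu1 nu1) / (2 * m + 1 + beta_ mu2 nu2) < p ->
  (1 + beta_ mu2 nu2) / (2 * m + 1 + beta_ mu1 nu1) < q ->
  0 <= Gamma_ m n p q (beta_ mu1 nu1) (beta_ mu2 nu2) ->
  ~ exists u v : R -> 'rV[R]_n -> R,
      energy_solution m mu1 mu2 nu1 nu2 p q M u0 u1 v0 v1 +oo%E u v.
Proof.
move=> _ m1 _ _ d1 d2 D1 D2 M0 supp I1 I2 p1 q1 _ _ G [u [v sol]].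
move: G; rewrite /Gamma_ subr_ge0 le_max => /orP[] G.
  by apply: (no_energy_solution m1 d1 d2 D1 D2 M0 supp I1 I2 p1 q1 _ sol); rewrite subr_ge0.
apply: (no_energy_solution m1 d2 d1 D2 D1 M0 _ I2 I1 q1 p1 _ (energy_solution_sym sol)).
  by move=> x [[[]|]|] xs; apply: supp; [left; right|right|left; left; left|left; left;
    right].
by rewrite subr_ge0 [q * p]mulrC.
Qed.
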